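(* For every valid function $p=p(n)$, the performance ratio of \textsc{oblivious} on $G(n,n,p)$ satisfies: (i) $\mathcal{R}_{\mathrm{O}}(p(n)) = 1$ if $p(n)=o(1/n)$; (ii) $\displaystyle \mathcal{R}_{\mathrm{O}}(p(n)) \ge \frac{c-ce^{(e^{-c}-1)}}{2c-(\gamma^*+\gamma_*+\gamma^*\gamma_* )}$ if $p(n)=c/n$ for a constant $c>0$; (iii) $\mathcal{R}_{\mathrm{O}}(p(n)) = 1-\frac{1}{e}$ if $p(n)=\omega(1/n)$.
   Context: For a positive integer $n$ and $p\in(0,1)$, $G(n,n,p)$ is the random bipartite graph with a set $I$ of $n$ ''bins'' and a set $J$ of $n$ ''balls'', each pair $(i,j)\in I\times J$ being an edge independently with probability $p$. Online model: balls arrive one at a time; when ball $j$ arrives its neighbor set $N(j)$ is revealed and the algorithm must immediately and irrevocably match $j$ to an unmatched bin or drop it; each bin is matched at most once. The matching size is the number of matched balls. The \textsc{oblivious} algorithm: on arrival of $j$, if $N(j)\ne\emptyset$ pick $i\in N(j)$ uniformly at random; if $i$ is unmatched match $j$ to $i$, otherwise drop $j$ ($j$ is dropped if $N(j)=\emptyset$). A function $p(n)$ is valid if for all $n>0$ it is monotonic in $n$ and satisfies $0<p(n)<1$. For an algorithm $A$, let $\mu_A(n,n,p(n))$ be its matching size on $G(n,n,p(n))$ and $\mu_*(n,n,p(n))$ the maximum matching size of $G(n,n,p(n))$; the performance ratio is $\mathcal{R}_A(p(n)) := \lim_{n\to\infty} \frac{\mathbb{E}[\mu_A(n,n,p(n))]}{\mathbb{E}[\mu_*(n,n,p(n))]}$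 (a lower bound $\mathcal{R}_A\ge x$ is to be read as $\liminf_{n\to\infty}$ of this ratio being $\ge x$). For $c>0$, $\gamma_*=\gamma_*(c)$ is the smallest root of $x=c\exp(-ce^{-x})$ and $\gamma^*=\gamma^*(c)=ce^{-\gamma_*}$. *)

(* Defs.v *)
From HB Require Import structures.
From mathcomp Require Import all_boot all_order all_algebra.
From mathcomp Require Import all_classical all_reals all_analysis.

Set Implicit Arguments.
Unset Strict Implicit.
Unset Printing Implicit Defensive.

Import Order.TTheory GRing.Theory Num.Theory.
Import numFieldNormedType.Exports.

Local Open Scope classical_set_scope.
Local Open Scope ring_scope.

Section BipartiteGraphs.
Variable n : nat.

(* A bipartite graph with n bins and n balls is its set of edges (bin, ball). *)
Definition bigraph := {set 'I_n * 'I_n}.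

Definition nbrs (G : bigraph) (j : 'I_n) : {set 'I_n} :=
  [set i | (i, j) \in G]%SET.

Definition is_matching (G M : bigraph) : bool :=
  (M \subset G) &&
  [forall e in M, forall f in M, ((e.1 == f.1) || (e.2 == f.2)) ==> (e == f)].

Definition max_matching_size (G : bigraph) : nat :=
  \max_(M : bigraph | is_matching G M) #|M|.

(* The random picks of OBLIVIOUS: w j is the bin picked by ball j, and
   w j = None when ball j has no neighbor. *)
Definition picks := {ffun 'I_n -> option 'I_n}.

Definition bin_matched (M : bigraph) (i : 'I_n) : bool :=
  [exists j, (i, j) \in M].

Definition oblivious_step (w : picks) (M : bigraph) (j : 'I_n) : bigraph :=
  if w j is Some i then
    if bin_matched M i then M else ((i, j) |: M)%SET
  else M.

(* Balls are labelled in order of arrival; [enum 'I_n] lists them increasingly. *)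
Definition oblivious_matching (w : picks) : bigraph :=
  foldl (oblivious_step w) finset.set0 (enum 'I_n).

Definition oblivious_size (w : picks) : nat := #|oblivious_matching w|.

End BipartiteGraphs.

Section Probability.
Variable R : realType.

Definition expect (T : finType) (P : T -> R) (X : T -> R) : R :=
  \sum_(t : T) P t * X t.

Definition gnnp (n : nat) (p : R) (G : bigraph n) : R :=
  \prod_(e : 'I_n * 'I_n) (if e \in G then p else 1 - p).

Definition pick_prob (n : nat) (G : bigraph n) (j : 'I_n) (o : option 'I_n) : R :=
  match o with
  | Some i => if i \in nbrs G j then #|nbrs G j|%:R^-1 else 0
  | None => if nbrs G j == finset.set0 then 1 else 0
  end.

(* Conditional law of the picks given the graph: independent over the balls. *)
Definition picks_law (n : nat) (G : bigraph n) (w : picks n) : R :=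
  \prod_(j < n) pick_prob G j (w j).

Definition expected_max_matching (n : nat) (p : R) : R :=
  expect (@gnnp n p) (fun G => (max_matching_size G)%:R).

Definition expected_oblivious (n : nat) (p : R) : R :=
  expect (@gnnp n p)
    (fun G => expect (picks_law G) (fun w => (oblivious_size w)%:R)).

Definition oblivious_ratio (p : nat -> R) (n : nat) : R :=
  expected_oblivious n (p n) / expected_max_matching n (p n).

Definition valid (p : nat -> R) : Prop :=
  (forall n, (0 < n)%N -> 0 < p n < 1) /\
  ((forall m n, (0 < m)%N -> (m <= n)%N -> p m <= p n) \/
   (forall m n, (0 < m)%N -> (m <= n)%N -> p n <= p m)).

Definition is_root (c x : R) : Prop := x = c * expR (- (c * expR (- x))).

Definition is_smallest_root (c x : R) : Prop :=
  is_root c x /\ forall y, is_root c y -> x <= y.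

(* gamma_lo and gamma_up are the constants written with a lower and an upper
   star; the default value 0 is never used when 0 < c (gamma_loP). *)
Definition gamma_lo (c : R) : R := xget 0 (is_smallest_root c).

Definition gamma_up (c : R) : R := c * expR (- gamma_lo c).

Lemma gamma_loP (c : R) : 0 < c -> is_smallest_root c (gamma_lo c).
Proof.
move=> c0; rewrite /gamma_lo; apply: xgetPex.
pose h (x : R) := c * expR (- (c * expR (- x))).
have h_ge0 x : 0 <= h x by rewrite mulr_ge0 ?expR_ge0 // ltW.
have h_mono x y : x <= y -> h x <= h y.
  by move=> xy; rewrite ler_pM2l // ler_expR lerN2 ler_pM2l // ler_expR lerN2.
pose P : set R := [set x | 0 <= x /\ h x <= x].
have lbP : lbound P 0 by move=> x [].
have Pc : P c.
  split; first exact: ltW.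
  rewrite /h -[leRHS]mulr1 ler_pM2l // -expR0 ler_expR oppr_le0.
  by rewrite mulr_ge0 ?expR_ge0 // ltW.
have infP : has_inf P by split; [exists c | exists 0].
have h_inf : h (inf P) <= inf P.
  apply: lb_le_inf; first by exists c.
  move=> x Px; apply: le_trans (Px.2); apply: h_mono.
  by apply: ge_inf => //; exists 0.
have inf_h : inf P <= h (inf P).
  apply: ge_inf; first by exists 0.
  by split => //; apply: h_mono.
exists (inf P); split; first by apply/eqP; rewrite eq_le inf_h h_inf.
move=> y ry; apply: ge_inf; first by exists 0.
by split; [rewrite ry; exact: h_ge0 | rewrite [leRHS]ry].
Qed.

End Probability.

(* Main.v *)
(* A ball picks each bin with probability q / n, where q = 1 - (1 - p)^n, and the
   picks are independent, so OBLIVIOUS matches n (1 - (1 - q / n)^n) bins on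
   average. A maximum matching matches at most the n q non-isolated balls, which
   gives (i). The vertices it leaves unmatched span no edge, so in the dense case
   (iii) a union bound over pairs of vertex sets makes it almost perfect.

   In the sparse case (ii) the maximum matching is bounded by a vertex cover read
   off leaf removal truncated at depth k. The message of v in a vertex set S not
   containing v is true when every neighbor u of v in S has a false message in
   S minus u. Given the edges inside S, it is true with probability
   (1 - p)^N, where N is the number of true messages in S at the previous depth.
   Removing a vertex changes a given message with probability O(1/n), so messages
   are nearly pairwise independent and N / n concentrates, by induction on the
   depth, around f_k with f_0 = 0 and f_(k+1) = exp (- c f_k). The cover consists
   of the bins with a certainly free neighbor and the balls with at least two
   neighbors that are not certainly used; since c f_(2t) increases to the smallest
   root of x = c exp (- c e^(-x)), its density tends to the bound of (ii). *)

Require Import Defs.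
From HB Require Import structures.
From mathcomp Require Import all_boot all_order all_algebra.
From mathcomp Require Import perm reals sequences exp.
From mathcomp Require Import lra ring.
Set Implicit Arguments.
Unset Strict Implicit.
Unset Printing Implicit Defensive.
Import Order.TTheory GRing.Theory Num.Theory.
Local Open Scope ring_scope.

(** * Expectation over the edges *)

Section Expectation.
Variables (R : realType) (T : finType) (P : T -> R).
Implicit Types X Y : T -> R.

Lemma eq_expect X Y : X =1 Y -> expect P X = expect P Y.
Proof. by move=> XY; apply: eq_bigr => t _; rewrite XY. Qed.

Lemma expectD X Y : expect P (fun t => X t + Y t) = expect P X + expect P Y.
Proof. by rewrite -big_split; apply: eq_bigr => t _; rewrite mulrDr. Qed.

Lemma expectZ a X : expect P (fun t => a * X t) = a * expect P X.
Proof. by rewrite mulr_sumr; apply: eq_bigr => t _; rewrite mulrCA. Qed.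

Lemma expectN X : expect P (fun t => - X t) = - expect P X.
Proof. by rewrite -mulN1r -expectZ; apply: eq_expect => t; rewrite mulN1r. Qed.

Lemma expectB X Y : expect P (fun t => X t - Y t) = expect P X - expect P Y.
Proof. by rewrite expectD expectN. Qed.

Lemma expect_sum (I : finType) (A : pred I) (X : I -> T -> R) :
  expect P (fun t => \sum_(i | A i) X i t) = \sum_(i | A i) expect P (X i).
Proof.
by rewrite exchange_big; apply: eq_bigr => t _; rewrite mulr_sumr.
Qed.

Hypothesis P_ge0 : forall t, 0 <= P t.

Lemma le_expect X Y : (forall t, X t <= Y t) -> expect P X <= expect P Y.
Proof. by move=> XY; apply: ler_sum => t _; rewrite ler_wpM2l. Qed.

Hypothesis P_sum1 : \sum_t P t = 1.

Lemma expect_cst a : expect P (fun=> a) = a.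
Proof. by rewrite /expect -mulr_suml P_sum1 mul1r. Qed.

End Expectation.

Section EdgeAveraging.
Variables (R : realType) (n : nat) (p : R).
Implicit Types (G : bigraph n) (e : 'I_n * 'I_n).
Local Notation E := (expect (@gnnp R n p)).

Lemma gnnp_ge0 G : 0 <= p <= 1 -> 0 <= gnnp p G.
Proof.
by move=> p01; apply: prodr_ge0 => e _; case: ifP => _; move: p01; lra.
Qed.

Lemma gnnp_sum1 : \sum_(G : bigraph n) gnnp p G = 1.
Proof.
transitivity (\prod_(e : 'I_n * 'I_n) (p + (1 - p))).
  by rewrite bigA_distr; apply: eq_big => // G; rewrite inE.
by apply: big1 => e _; rewrite addrC subrK.
Qed.

Lemma gnnp_setU1 e G : e \notin G -> (1 - p) * gnnp p (e |: G) = p * gnnp p G.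
Proof.
move=> eG; rewrite /gnnp (bigD1 e) //= [in RHS](bigD1 e) //= setU11 (negPf eG).
rewrite mulrCA; congr (_ * (_ * _)); apply: eq_bigr => f fe.
by rewrite in_setU1 (negPf fe).
Qed.

(** Independence of the edge [e], expressed without conditioning: [X] takes the same value on the
    two graphs that differ only in [e]. *)
Definition edge_free (A : Type) e (X : bigraph n -> A) :=
  forall G, X (e |: G) = X G.

(** Adding [e] pairs the graphs without [e] with those containing it, and the weights of a pair are
    in ratio [1 - p] to [p]. The parts [A] and [B] of the expectation with and without [e] thus
    satisfy [(1 - p) * A = p * B], while [A + B = E Y]. *)
Lemma expect_edge e (Y : bigraph n -> R) : edge_free e Y ->
  E (fun G => (e \in G)%:R * Y G) = p * E Y.
Proof.
move=> eY; set A := LHS.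
pose B := E (fun G => (e \notin G)%:R * Y G).
have EY : E Y = A + B.
  rewrite -expectD; apply: eq_expect => G.
  by case: (e \in G); rewrite /= mul1r mul0r ?addr0 ?add0r.
have AE : A = \sum_(G : bigraph n | e \in G) gnnp p G * Y G.
  rewrite big_mkcond; apply: eq_bigr => G _.
  by case: (e \in G); rewrite ?mul1r // mul0r mulr0.
have BE : B = \sum_(G : bigraph n | e \notin G) gnnp p G * Y G.
  rewrite [RHS]big_mkcond; apply: eq_bigr => G _.
  by case: (e \in G); rewrite /= ?mul1r // mul0r mulr0.
have AB : (1 - p) * A = p * B.
  rewrite AE BE !mulr_sumr.
  rewrite (reindex_onto (fun G : bigraph n => e |: G)
    (fun G => G :\ e)) /=; last by move=> G; exact: setD1K.
  rewrite [LHS](eq_bigl (fun G : bigraph n => e \notin G)).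
    by apply: eq_bigr => G eG; rewrite eY !mulrA gnnp_setU1.
  move=> G; rewrite setU11 /=; apply/eqP/idP => [<-|/setU1K //].
  by rewrite !inE eqxx.
by rewrite EY mulrDr -AB; ring.
Qed.

(** Distinct edges are averaged out one at a time: the coefficients, [Z] and the remaining factors
    are free of the edge being handled. All later uses of independence between edges go through this
    form. *)
Lemma expect_edges (I : eqType) (ed : I -> 'I_n * 'I_n) (s : seq I)
    (a b : I -> bigraph n -> R) (Z : bigraph n -> R) :
  injective ed -> uniq s ->
  (forall i j, i \in s -> j \in s -> edge_free (ed i) (a j)) ->
  (forall i j, i \in s -> j \in s -> edge_free (ed i) (b j)) ->
  (forall i, i \in s -> edge_free (ed i) Z) ->
  E (fun G => \prod_(i <- s) (a i G + b i G * (ed i \in G)%:R) * Z G) =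
  E (fun G => \prod_(i <- s) (a i G + p * b i G) * Z G).
Proof.
move=> ed_inj; elim: s Z => [|i s IH] Z /=.
  by move=> _ _ _ _; apply: eq_expect => G; rewrite !big_nil.
move=> /andP[is_ us] Fa Fb FZ.
pose W G := \prod_(j <- s) (a j G + b j G * (ed j \in G)%:R) * Z G.
have FW : edge_free (ed i) W.
  move=> G; rewrite /W FZ ?mem_head //; congr (_ * _).
  apply: eq_big_seq => j js.
  have jis : j \in i :: s by rewrite inE js orbT.
  rewrite (Fa i j) ?(Fb i j) ?mem_head //.
  rewrite in_setU1 (inj_eq ed_inj); case: eqP => // ji.
  by rewrite -ji js in is_.
transitivity (E (fun G => (a i G + p * b i G) * W G)).
  transitivity (E (fun G => a i G * W G + (ed i \in G)%:R * (b i G * W G))).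
    by apply: eq_expect => G; rewrite big_cons /W; ring.
  rewrite expectD expect_edge; last by move=> G; rewrite FW Fb ?mem_head.
  by rewrite -expectZ -expectD; apply: eq_expect => G; ring.
transitivity (E (fun G => \prod_(j <- s) (a j G + b j G * (ed j \in G)%:R) *
    ((a i G + p * b i G) * Z G))).
  by apply: eq_expect => G; rewrite /W; ring.
rewrite IH //.
- by apply: eq_expect => G; rewrite big_cons; ring.
- by move=> j k js ks; apply: Fa; rewrite inE ?js ?ks orbT.
- by move=> j k js ks; apply: Fb; rewrite inE ?js ?ks orbT.
- move=> j js G; rewrite Fa ?Fb ?FZ ?inE ?js ?eqxx ?orbT //.
Qed.

End EdgeAveraging.

(** * Edges from one vertex to a random set *)

Section Stars.
Variables (R : realType) (n : nat) (p : R).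
Hypothesis p01 : 0 <= p <= 1.
Implicit Types (G : bigraph n) (b : bool) (x y : 'I_n).
Local Notation E := (expect (@gnnp R n p)).

(* Vertices are pairs [(b, x)]: bins for [b = true], balls for [b = false]. *)
Definition edge b x y : 'I_n * 'I_n := if b then (x, y) else (y, x).

Lemma edge_inj b x : injective (edge b x).
Proof. by move=> y z; rewrite /edge; case: b => -[]. Qed.

Lemma edge_endpoint b x y b' x' y' :
  edge b x y = edge b' x' y' -> (b', x') = (b, x) \/ (b', x') = (~~ b, y).
Proof. by rewrite /edge; case: b; case: b' => -[-> ->]; auto. Qed.

Definition star_free (A : Type) b x (X : bigraph n -> A) :=
  forall y, edge_free (edge b x y) X.

(** Once the edges away from [(b, x)] are fixed, so are [W] and [Z], and the edges from [(b, x)] to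
    [W] are absent independently. *)
Lemma expect_star0 b x (W : bigraph n -> {set 'I_n}) (Z : bigraph n -> R) :
  star_free b x W -> star_free b x Z ->
  E (fun G => [forall y in W G, edge b x y \notin G]%:R * Z G) =
  E (fun G => (1 - p) ^+ #|W G| * Z G).
Proof.
(* Membership in [W G] is put into the coefficients, so that the product runs over all [y] and its
   index set does not depend on [G]. *)
move=> FW FZ; pose t y G : R := - (y \in W G)%:R.
transitivity (E (fun G => \prod_(y <- index_enum 'I_n)
    (1 + t y G * (edge b x y \in G)%:R) * Z G)).
  apply: eq_expect => G; congr (_ * _); rewrite /t.
  case: (boolP [forall y in _, _]) => [/forall_inP H|].
    apply/esym; apply: big1 => y _; case: (boolP (y \in W G)) => yW.
      by rewrite (negPf (H _ yW)) mulr0 addr0.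
    by rewrite oppr0 mul0r addr0.
  rewrite negb_forall => /existsP[y]; rewrite negb_imply negbK => /andP[yW yG].
  by rewrite (bigD1 y) //= yW yG mulr1 subrr mul0r.
rewrite expect_edges //; [|exact: edge_inj|exact: index_enum_uniq|].
  apply: eq_expect => G; congr (_ * _).
  transitivity (\prod_(y in W G) (1 - p)); last by rewrite prodr_const.
  rewrite [RHS]big_mkcond; apply: eq_bigr => y _; rewrite /t.
  by case: (y \in W G); rewrite /= ?mulrN1 // oppr0 mulr0 addr0.
by move=> y z _ _ G; rewrite /t FW.
Qed.

(** The event splits into no edge and exactly one edge, towards some [z] in [W]. The latter has
    conditional probability [p (1 - p)^(|W| - 1)]; raising the exponent to [|W|] gives the
    inequality. *)
Lemma expect_star1 b x (W : bigraph n -> {set 'I_n}) : star_free b x W ->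
  E (fun G => (1 - p) ^+ #|W G| * (1 + p * #|W G|%:R)) <=
  E (fun G => (#|[set y in W G | edge b x y \in G]| <= 1)%N%:R).
Proof.
move=> FW; have P0 G := gnnp_ge0 G p01.
pose none G := [forall y in W G, edge b x y \notin G].
(* The coefficients make the factor at [z] the presence of its edge and every other factor the
   absence of an edge into [W]. *)
pose a z y G : R := (y != z)%:R.
pose t z y G : R := if y == z then (y \in W G)%:R else - (y \in W G)%:R.
pose one z G := \prod_(y <- index_enum 'I_n)
    (a z y G + t z y G * (edge b x y \in G)%:R).
have oneE z G : one z G = [&& z \in W G, edge b x z \in G &
    [forall y in W G :\ z, edge b x y \notin G]]%:R.
  rewrite /one (bigD1 z) //= /a /t eqxx add0r.
  case: (z \in W G); case: (edge b x z \in G); rewrite /= ?(mul0r, mul1r, mulr0) //.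
  case: (boolP [forall y in _, _]) => [/forall_inP H|].
    apply: big1 => y yz; rewrite yz (negPf yz); case: (boolP (y \in W G)) => yW.
      by rewrite (negPf (H _ _)) ?mulr0 ?addr0 // in_setD1 yz.
    by rewrite oppr0 mul0r addr0.
  rewrite negb_forall => /existsP[y]; rewrite negb_imply negbK in_setD1.
  move=> /andP[/andP[yz yW] yG].
  by rewrite (bigD1 y) //= yz (negPf yz) yW yG mulr1 subrr mul0r.
apply: (@le_trans _ _ (E (fun G => (none G)%:R + \sum_z one z G))); last first.
  apply: le_expect => // G; under eq_bigr do rewrite oneE.
  set D := [set y in W G | _].
  case: (ltnP 1 #|D|) => D1.
    have [y [z [yD zD yz]]] : exists y, exists z, [/\ y \in D, z \in D & y != z].
      by case/card_gt1P: D1 => y [z [yD zD yz]]; exists y, z.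
    rewrite !inE in yD zD; case/andP: yD zD => yW yG /andP[zW zG].
    rewrite /none (_ : [forall _ in _, _] = false) ?add0r; last first.
      by apply/negbTE/forall_inPn; exists y => //; rewrite negbK.
    rewrite big1 // => u _.
    suff -> : [forall v in W G :\ u, edge b x v \notin G] = false by rewrite !andbF.
    apply/negbTE/forall_inPn; case: (eqVneq y u) => [yu|yu].
      by exists z; rewrite ?negbK // in_setD1 zW -yu eq_sym yz.
    by exists y; rewrite ?negbK // in_setD1 yW yu.
  case: (boolP (none G)) => [/forall_inP N|].
    rewrite big1 ?addr0 // => z _.
    case: (boolP (z \in W G)) => //= zW; by rewrite (negPf (N _ zW)).
  rewrite negb_forall => /existsP[z]; rewrite negb_imply negbK => /andP[zW zG].
  rewrite add0r (bigD1 z) //= big1 ?addr0; first by case: [&& _, _ & _].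
  move=> y yz; case: (boolP (y \in W G)) => //= yW.
  case: (boolP (edge b x y \in G)) => //= yG.
  suff -> : [forall v in W G :\ y, edge b x v \notin G] = false by [].
  by apply/negbTE/forall_inPn; exists z; rewrite ?negbK // in_setD1 zW eq_sym yz.
rewrite expectD expect_sum.
have -> : E (fun G => (none G)%:R) = E (fun G => (1 - p) ^+ #|W G|).
  transitivity (E (fun G => (none G)%:R * 1)).
    by apply: eq_expect => G; rewrite mulr1.
  by rewrite expect_star0 //; apply: eq_expect => G; rewrite mulr1.
have Eone z : E (fun G => (1 - p) ^+ #|W G| * p * (z \in W G)%:R) <= E (one z).
  have -> : E (one z) = E (fun G => one z G * 1).
    by apply: eq_expect => G; rewrite mulr1.
  rewrite expect_edges //; [|exact: edge_inj|exact: index_enum_uniq|]; last first.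
    by move=> y u _ _ G; rewrite /t FW.
  apply: le_expect => // G; rewrite mulr1 (bigD1 z) //= /a /t eqxx add0r.
  case: (boolP (z \in W G)) => zW; last by rewrite !mulr0 mul0r.
  rewrite !mulr1 mulrC ler_wpM2l //; first by case/andP: p01.
  have -> : \prod_(i < n | i != z) ((i != z)%:R +
      p * (if i == z then (i \in W G)%:R else - (i \in W G)%:R)) =
      (1 - p) ^+ #|W G :\ z|.
    transitivity (\prod_(y in W G :\ z) (1 - p)); last by rewrite prodr_const.
    rewrite [RHS]big_mkcond [LHS]big_mkcond; apply: eq_bigr => y _; rewrite in_setD1.
    case: (eqVneq y z) => //= yz; case: (y \in W G); first by rewrite mulrN1.
    by rewrite oppr0 mulr0 addr0.
  by rewrite (cardsD1 z (W G)) zW ler_wiXn2l //; move: p01; lra.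
apply: le_trans (lerD (lexx _) (ler_sum _ (fun z _ => Eone z))).
rewrite -expect_sum -expectD; apply: le_expect => // G.
rewrite mulrDr mulr1 lerD2l -mulr_sumr mulrA.
by rewrite -sum1_card big_mkcond -natr_sum.
Qed.

End Stars.

(** * Messages along self-avoiding walks *)

Section Messages.
Variable n : nat.
Implicit Types (G : bigraph n) (S : {set bool * 'I_n}) (b : bool) (x y : 'I_n).

(* Truncated leaf removal at [(b, x)] inside the vertex set [S], which does not
   contain [(b, x)]: at even depth [msg] says that the vertex is certainly left
   free by its neighbors in [S], at odd depth that it is not certainly used. *)
Fixpoint msg k G S b x : bool :=
  if k is k'.+1 then
    [forall y, ((~~ b, y) \in S) && msg k' G (S :\ (~~ b, y)) (~~ b) y
               ==> (edge b x y \notin G)]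
  else false.

Definition alive k G S b : {set 'I_n} :=
  [set y | ((b, y) \in S) && msg k G (S :\ (b, y)) b y].

Lemma msgS k G S b x :
  msg k.+1 G S b x = [forall y in alive k G S (~~ b), edge b x y \notin G].
Proof. by apply: eq_forallb => y; rewrite inE. Qed.

(** The recursion reads only edges inside [S] and edges from [(b, x)] into [S]. This is what
    removing visited vertices achieves: the edges at any other vertex remain fresh and can be
    averaged separately. *)
Lemma msg_star_free k S b x b' x' :
  (b', x') \notin S -> (b', x') != (b, x) ->
  star_free b' x' (fun G => msg k G S b x).
Proof.
elim: k S b x => [|k IH] S b x wS wx y G //=.
apply: eq_forallb => z; case: (boolP ((~~ b, z) \in S)) => //= zS.
have wz : (b', x') != (~~ b, z) by apply: contraNneq wS => ->.
rewrite (IH (S :\ (~~ b, z)) (~~ b) z) //; last by rewrite in_setD1 negb_and wS orbT.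
congr (_ ==> ~~ _); rewrite in_setU1; case: eqP => // /edge_endpoint[] h.
  by rewrite h eqxx in wx.
by rewrite h eqxx in wz.
Qed.

Lemma alive_star_free k S b b' x' : (b', x') \notin S ->
  star_free b' x' (fun G => alive k G S b).
Proof.
move=> wS y G; apply/setP => z; rewrite !inE.
case: (boolP ((b, z) \in S)) => //= zS.
apply: msg_star_free; first by rewrite in_setD1 negb_and wS orbT.
by apply: contraNneq wS => ->.
Qed.

(** Each level of the recursion negates the messages and swaps the sides, so a message increases
    with the vertices of its own side and decreases with those of the other. *)
Lemma msg_mono k G S S' b x :
  (forall y, (b, y) \in S -> (b, y) \in S') ->
  (forall y, (~~ b, y) \in S' -> (~~ b, y) \in S) ->
  msg k G S b x -> msg k G S' b x.
Proof.
elim: k S S' b x => [|k IH] S S' b x sub sup //= /forallP H.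
apply/forallP => y; apply/implyP => /andP[yS' m].
have := H y; rewrite sup //=; move=> /implyP; apply.
apply: (IH _ _ _ _ _ _ m) => z; rewrite !in_setD1 ?negbK => /andP[-> zS] /=; first exact: sup.
exact: sub.
Qed.

(** Depth 0 is constantly false, hence below depth 2, and each further level reverses the
    implication: even depths increase, odd depths decrease. *)
Lemma msg_level k G S b x :
  if odd k then msg k.+2 G S b x -> msg k G S b x
  else msg k G S b x -> msg k.+2 G S b x.
Proof.
elim: k S b x => [|k IH] S b x //.
rewrite [odd k.+1]/=; case: (odd k) IH => /= IH /forallP H; apply/forallP => y.
  apply/implyP => /andP[yS m]; have := H y; rewrite yS /=; move=> /implyP; apply.
  exact: (IH _ (~~ b) y m).
apply/implyP => /andP[yS m]; have := H y; rewrite yS /=; move=> /implyP; apply.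
exact: (IH _ (~~ b) y m).
Qed.

Definition used_bins k G : {set 'I_n} :=
  [set i | ~~ msg k.+2 G [set~ (true, i)] true i].

Definition shared_balls k G : {set 'I_n} :=
  [set j | (1 < #|[set i in alive k G [set~ (false, j)] true
                  | edge false j i \in G]|)%N].

(** If [i] is not in the cover, its neighbor [j] has a false message at depth [k + 1], so [j] has
    another neighbor [i'] with a true message at depth [k]. By [msg_level] the message of [i] at
    depth [k] is true as well, so [j] has two alive neighbors. Both messages move to the vertex set
    of [j] by [msg_mono]. *)
Lemma edge_covered k G i j : odd k ->
  (i, j) \in G -> (i \in used_bins k G) || (j \in shared_balls k G).
Proof.
move=> ok ijG; case: (boolP (i \in _)) => //=; rewrite inE negbK => mi.
have jA : j \notin alive k.+1 G [set~ (true, i)] false.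
  by apply: contraL ijG => jA; move: mi; rewrite msgS => /forall_inP/(_ j jA).
move: jA; rewrite inE !in_setC1 msgS /= => /forall_inPn[i' + ]; rewrite !inE negbK /=.
move=> /andP[i'i m] i'j.
apply/card_gt1P; exists i, i'; split.
- rewrite !inE ijG andbT /=.
  move: (msg_level k G [set~ (true, i)] true i); rewrite ok => /(_ mi).
  by apply: msg_mono => y; rewrite !inE /= ?andbT // => /andP[].
- rewrite !inE i'j andbT /=.
  by apply: (msg_mono _ _ m) => y; rewrite !inE /= ?andbT // => /andP[].
- by apply: contraNneq i'i => ->.
Qed.

(** Weak duality: sending each matching edge to an endpoint in the cover is injective on each
    side. *)
Lemma matching_le_cover G (A B : {set 'I_n}) :
  (forall i j, (i, j) \in G -> (i \in A) || (j \in B)) ->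
  (max_matching_size G <= #|A| + #|B|)%N.
Proof.
move=> cover; apply/bigmax_leqP => M /andP[/subsetP MG /forall_inP inj].
have inj' e f : e \in M -> f \in M -> (e.1 == f.1) || (e.2 == f.2) -> e = f.
  by move=> eM fM h; have /forall_inP/(_ f fM)/implyP/(_ h)/eqP := inj e eM.
pose MA := [set e in M | e.1 \in A]; pose MB := [set e in M | e.2 \in B].
have MU : M \subset MA :|: MB.
  apply/subsetP => -[i j] eM; rewrite !inE eM /=; exact: cover (MG _ eM).
apply: (leq_trans (subset_leq_card MU)).
apply: (leq_trans (leq_card_setU _ _)); apply: leq_add.
  rewrite -(card_in_imset (f := fst)) ?subset_leq_card //.
    by apply/subsetP => _ /imsetP[e + ->]; rewrite inE => /andP[].
  by move=> e f; rewrite !inE => /andP[eM _] /andP[fM _] h; apply: inj'; rewrite ?h ?eqxx.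
rewrite -(card_in_imset (f := snd)) ?subset_leq_card //.
  by apply/subsetP => _ /imsetP[e + ->]; rewrite inE => /andP[].
by move=> e f; rewrite !inE => /andP[eM _] /andP[fM _] h; apply: inj'; rewrite ?h ?eqxx ?orbT.
Qed.

End Messages.

(** * Law of a message and its sensitivity to one vertex *)

Section MessageLaw.
Variables (R : realType) (n : nat) (p : R).
Hypothesis p01 : 0 <= p <= 1.
Implicit Types (G : bigraph n) (S : {set bool * 'I_n}) (b : bool) (x y : 'I_n).
Local Notation E := (expect (@gnnp R n p)).

Lemma expect_msg k S b x (Z : bigraph n -> R) : (b, x) \notin S ->
  star_free b x Z ->
  E (fun G => (msg k.+1 G S b x)%:R * Z G) =
  E (fun G => (1 - p) ^+ #|alive k G S (~~ b)| * Z G).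
Proof.
move=> xS FZ; rewrite -(@expect_star0 _ _ _ b x) //.
  by apply: eq_expect => G; rewrite msgS.
exact: alive_star_free.
Qed.

Fixpoint influence k : R :=
  if k is k'.+1 then p + n%:R * p * influence k' else 0.

Lemma influence_ge0 k : 0 <= influence k.
Proof.
by elim: k => //= k IHk; case/andP: p01 => p0 _; rewrite addr_ge0 // !mulr_ge0.
Qed.

(** A message can flip only through an edge to [w] itself or through an edge to some [y] whose own
    message flips. The edge to [y] is independent of that flip, and the union bound is the recursion
    of [influence], which is of order [1 / n] when [p = c / n]. *)
Lemma msg_influence k S b x w : (b, x) \notin S -> w \notin S -> w != (b, x) ->
  E (fun G => (msg k G (w |: S) b x != msg k G S b x)%:R) <= influence k.
Proof.
have P0 G := gnnp_ge0 G p01.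
elim: k S b x => [|k IH] S b x xS wS wx.
  by rewrite /= [leLHS]big1 // => G _; rewrite mulr0.
pose d y G : R :=
  (msg k G (w |: (S :\ (~~ b, y))) (~~ b) y != msg k G (S :\ (~~ b, y)) (~~ b) y)%:R.
(* The first term is charged whatever the side of [w]; if [w] lies on the side of [x] it only
   enlarges the bound. *)
apply: (@le_trans _ _ (E (fun G => (edge b x w.2 \in G)%:R * 1 +
   \sum_(y | (~~ b, y) \in S) (edge b x y \in G)%:R * d y G))).
  apply: le_expect => // G.
  have s0 : 0 <= \sum_(y | (~~ b, y) \in S) (edge b x y \in G)%:R * d y G.
    by apply: sumr_ge0 => y _; rewrite mulr_ge0.
  case: (eqVneq (msg k.+1 G (w |: S) b x) (msg k.+1 G S b x)) => [|/eqP ne].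
    by rewrite mulr1 addr_ge0.
  case: (boolP (edge b x w.2 \in G)) => wG; first by rewrite mulr1 lerDl.
  rewrite mul0r add0r.
  have [y yS /andP[yG dy]] : exists2 y, (~~ b, y) \in S & (edge b x y \in G) &&
     (msg k G (w |: (S :\ (~~ b, y))) (~~ b) y != msg k G (S :\ (~~ b, y)) (~~ b) y).
    apply/exists_inP; apply: contra_notT ne => /exists_inPn H /=.
    apply: eq_forallb => y; rewrite in_setU1.
    case: (boolP ((~~ b, y) \in S)) => [yS|yS]; last first.
      rewrite orbF andFb /=; case: eqP => //= wy.
      by rewrite -wy in wG; rewrite wG implybT.
    rewrite orbT /= setDUl (_ : [set w] :\ (~~ b, y) = [set w]); last first.
      by apply/setDidPl; rewrite disjoints1 inE; apply: contraNneq wS => ->.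
    have := H y yS; case: (edge b x y \in G); last by rewrite !implybT.
    by rewrite /= negbK => /eqP ->.
  rewrite (bigD1 y) //= yG /d dy mulr1 lerDl.
  by apply: sumr_ge0 => z _; rewrite mulr_ge0.
rewrite expectD expect_sum expect_edge // expect_cst ?gnnp_sum1 // mulr1 lerD2l.
apply: (@le_trans _ _ (\sum_(y < n) p * influence k)); last first.
  by rewrite sumr_const card_ord -[leLHS]mulr_natl mulrA.
rewrite big_mkcond; apply: ler_sum => y _; case: ifP => yS; last first.
  by rewrite mulr_ge0 ?influence_ge0 //; case/andP: p01.
rewrite expect_edge.
  rewrite ler_wpM2l //; first by case/andP: p01.
  apply: IH; first by rewrite !inE eqxx.
    by rewrite in_setD1 negb_and wS orbT.
  by apply: contraNneq wS => ->.
have yx : (b, x) != (~~ b, y) by case: (b).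
move=> G; rewrite /d; congr (_ != _)%:R; apply: msg_star_free => //.
  by rewrite !inE negb_or eq_sym wx /= negb_and xS orbT.
by rewrite !inE negb_and xS orbT.
Qed.

End MessageLaw.

(** * Concentration of the number of positive messages *)

Section ExpBounds.
Variable R : realType.
Implicit Types x y p : R.

(** Follows from [exp x >= 1 + x] and [(1 + x) (1 - x + x^2) = 1 + x^3]. *)
Lemma expRN_le x : 0 <= x -> expR (- x) <= 1 - x + x ^+ 2.
Proof.
move=> x0; rewrite expRN.
have x1 : 0 < 1 + x by lra.
apply: (@le_trans _ _ (1 + x)^-1).
  by rewrite lef_pV2 ?posrE ?expR_gt0 // expR_ge1Dx.
rewrite -(ler_pM2l x1) mulfV ?gt_eqF //.
have : 0 <= x ^+ 3 by rewrite exprn_ge0.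
by rewrite !exprS expr0; nra.
Qed.

Lemma lerB_exp (a b : R) m : 0 <= b <= a -> a <= 1 ->
  a ^+ m - b ^+ m <= m%:R * (a - b).
Proof.
move=> /andP[b0 ba] a1; elim: m => [|m IH]; first by rewrite !expr0; lra.
have -> : a ^+ m.+1 - b ^+ m.+1 = a * (a ^+ m - b ^+ m) + b ^+ m * (a - b).
  by rewrite !exprS; ring.
have bm : b ^+ m <= 1 by rewrite exprn_ile1 // (le_trans ba).
have ab : 0 <= a ^+ m - b ^+ m by rewrite subr_ge0 lerXn2r // nnegrE; lra.
rewrite -natr1 mulrDl mul1r; apply: lerD; first by apply: le_trans IH; nra.
by nra.
Qed.

(** Quantitative Poisson approximation: with [p = c / n] and [m <= n] the error is at most
    [c^2 / n]. *)
Lemma expR_onem p m : 0 <= p <= 1 ->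
  (1 - p) ^+ m <= expR (- (p * m%:R)) <= (1 - p) ^+ m + m%:R * p ^+ 2.
Proof.
move=> /andP[p0 p1]; rewrite -mulNr expRM_natr.
have ge : 1 - p <= expR (- p) by have := expR_ge1Dx (- p); lra.
apply/andP; split; first by rewrite lerXn2r ?nnegrE ?expR_ge0 //; lra.
rewrite -lerBlDl; apply: (le_trans (lerB_exp _ _ _)).
- by rewrite ge andbT; lra.
- by rewrite expR_le1; lra.
- by rewrite ler_wpM2l // lerBlDl; have := expRN_le p0; lra.
Qed.

Lemma dist_expRN x y : 0 <= x -> 0 <= y ->
  `|expR (- x) - expR (- y)| <= `|x - y|.
Proof.
wlog xy : x y / x <= y => [hw x0 y0|x0 _].
  case/orP: (le_total x y) => h; first exact: hw.
  by rewrite distrC [leRHS]distrC hw.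
rewrite [leRHS]distrC !ger0_norm ?subr_ge0 ?ler_expR ?lerN2 //.
have -> : expR (- y) = expR (- x) * expR (- (y - x)) by rewrite -expRD; congr expR; ring.
have e1 : expR (- x) <= 1 by rewrite expR_le1; lra.
have := expR_ge1Dx (- (y - x)); have := expR_ge0 (- x); nra.
Qed.

End ExpBounds.

Section Concentration.
Variables (R : realType) (c : R).
Hypothesis c0 : 0 < c.

Fixpoint msg_lim k : R := if k is k'.+1 then expR (- (c * msg_lim k')) else 0.

Lemma msg_lim01 k : 0 <= msg_lim k <= 1.
Proof.
elim: k => [|k /andP[IH _]] /=; first by rewrite lexx ler01.
by rewrite expR_ge0 expR_le1 oppr_le0 mulr_ge0 // ltW.
Qed.

Section FixedSize.
Variable n : nat.
Hypothesis cn : c <= n%:R.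
Let p := c / n%:R.
Local Notation E := (expect (@gnnp R n p)).
Implicit Types (G : bigraph n) (S : {set bool * 'I_n}) (b : bool).

Let n0 : 0 < n%:R :> R. Proof. exact: lt_le_trans cn. Qed.

Lemma sparse01 : 0 <= p <= 1.
Proof.
by rewrite /p divr_ge0 ?ler_pdivrMr ?mul1r //; apply: ltW.
Qed.

Lemma dist_pow_msg_lim (U : nat) (f : R) : (U <= n)%N -> 0 <= f ->
  `|(1 - p) ^+ U - expR (- (c * f))| <= (c ^+ 2 + c * `|U%:R - n%:R * f|) / n%:R.
Proof.
move=> Un f0; have pU0 : 0 <= p * U%:R by rewrite mulr_ge0 //; case/andP: sparse01.
have -> : (1 - p) ^+ U - expR (- (c * f)) =
  ((1 - p) ^+ U - expR (- (p * U%:R))) + (expR (- (p * U%:R)) - expR (- (c * f))) by ring.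
apply: (le_trans (ler_normD _ _)); rewrite mulrDl; apply: lerD.
  have /andP[le1 le2] := expR_onem U sparse01.
  rewrite distrC ger0_norm ?subr_ge0 //.
  apply: (@le_trans _ _ (U%:R * p ^+ 2)); first lra.
  apply: (@le_trans _ _ (n%:R * p ^+ 2)).
    by rewrite ler_wpM2r ?sqr_ge0 ?ler_nat.
  by rewrite /p le_eqVlt; apply/orP; left; apply/eqP; field; rewrite gt_eqF.
have cf0 : 0 <= c * f by rewrite mulr_ge0 // ltW.
apply: (le_trans (dist_expRN pU0 cf0)).
have -> : p * U%:R - c * f = c / n%:R * (U%:R - n%:R * f).
  by rewrite /p; field; rewrite gt_eqF.
rewrite normrM ger0_norm; last by rewrite divr_ge0 // ltW.
by rewrite mulrAC.
Qed.

Lemma alive_le k G S b : (#|alive k G S b| <= n)%N.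
Proof. by rewrite -[leqRHS]card_ord max_card. Qed.

(** Induction step, first half: a mean square deviation of order [n] for the count at depth [k]
    becomes one of order [1 / n] for the conditional probability of a message at depth [k + 1]. *)
Lemma expect_pow_msg_lim k S b C :
  E (fun G => (#|alive k G S b|%:R - n%:R * msg_lim k) ^+ 2) <= C * n%:R ->
  E (fun G => ((1 - p) ^+ #|alive k G S b| - msg_lim k.+1) ^+ 2) <=
  (2 * c ^+ 4 + 2 * c ^+ 2 * C) / n%:R.
Proof.
move=> H; have P0 G := gnnp_ge0 G sparse01.
have n1 : 1 <= n%:R :> R by rewrite ler1n; move: n0; rewrite ltr0n.
apply: (@le_trans _ _ (E (fun G => (2 * c ^+ 4) / n%:R ^+ 2 +
    2 * c ^+ 2 / n%:R ^+ 2 * (#|alive k G S b|%:R - n%:R * msg_lim k) ^+ 2))).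
  apply: le_expect => // G; set U := #|_|; set f := msg_lim k.
  have f0 : 0 <= f by case/andP: (msg_lim01 k).
  have := dist_pow_msg_lim (alive_le k G S b) f0; rewrite -/U /= -/f.
  set d := (1 - p) ^+ U - _; set D := U%:R - _ => dD.
  apply: (@le_trans _ _ (((c ^+ 2 + c * `|D|) / n%:R) ^+ 2)).
    by rewrite -[d ^+ 2]real_normK ?num_real // lerXn2r // nnegrE ?(le_trans _ dD).
  rewrite -[D ^+ 2]real_normK ?num_real // expr_div_n.
  rewrite (_ : _ + _ * `|D| ^+ 2 =
     (2 * c ^+ 4 + 2 * c ^+ 2 * `|D| ^+ 2) / n%:R ^+ 2); last by ring.
  rewrite ler_wpM2r ?invr_ge0 ?sqr_ge0 //.
  rewrite -subr_ge0 (_ : _ - _ = (c ^+ 2 - c * `|D|) ^+ 2) ?sqr_ge0 //; ring.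
rewrite expectD expect_cst ?gnnp_sum1 // expectZ [leRHS]mulrDl; apply: lerD.
  rewrite ler_pM2l ?lef_pV2 ?posrE ?exprn_gt0 //; last by rewrite mulr_gt0 ?exprn_gt0.
  by rewrite expr2 ler_peMl // ltW.
apply: (@le_trans _ _ (2 * c ^+ 2 / n%:R ^+ 2 * (C * n%:R))).
  by rewrite ler_wpM2l // divr_ge0 // ?exprn_ge0 // mulr_ge0 // exprn_ge0 // ltW.
by rewrite le_eqVlt; apply/orP; left; apply/eqP; field; rewrite gt_eqF.
Qed.

(** Neither vertex lies in [S], so given the edges inside [S] the two messages are independent with
    the same conditional probability. Averaging them in turn makes the covariance term a square. *)
Lemma expect_msg_pair k S b x y : x != y -> (b, x) \notin S -> (b, y) \notin S ->
  let f := msg_lim k.+1 in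
  E (fun G => ((msg k.+1 G S b x)%:R - f) * ((msg k.+1 G S b y)%:R - f)) =
  E (fun G => ((1 - p) ^+ #|alive k G S (~~ b)| - f) ^+ 2).
Proof.
move=> xy xS yS f.
have swap z (Z : bigraph n -> R) : (b, z) \notin S -> star_free b z Z ->
    E (fun G => ((msg k.+1 G S b z)%:R - f) * Z G) =
    E (fun G => ((1 - p) ^+ #|alive k G S (~~ b)| - f) * Z G).
  move=> zS FZ; transitivity (E (fun G => (msg k.+1 G S b z)%:R * Z G - f * Z G)).
    by apply: eq_expect => G; rewrite mulrBl.
  by rewrite expectB expect_msg // -expectB; apply: eq_expect => G; rewrite mulrBl.
rewrite swap //; last first.
  by move=> z G; rewrite (msg_star_free k.+1 xS) // xpair_eqE eqxx.
transitivity (E (fun G => ((msg k.+1 G S b y)%:R - f) *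
     ((1 - p) ^+ #|alive k G S (~~ b)| - f))).
  by apply: eq_expect => G; rewrite mulrC.
rewrite swap //.
by move=> z G; rewrite (alive_star_free k (~~ b) yS).
Qed.

(** Induction step, second half: the square of the centered count is expanded over pairs of
    vertices. Off the diagonal both vertices are removed from [S], hence the bound [r.+2] in the
    hypothesis. *)
Lemma alive_second_moment k S b r B : 0 <= B ->
  (#|~: S| <= r)%N ->
  (forall S', (#|~: S'| <= r.+2)%N ->
    E (fun G => ((1 - p) ^+ #|alive k G S' (~~ b)| - msg_lim k.+1) ^+ 2)
    <= B / n%:R) ->
  E (fun G => (#|alive k.+1 G S b|%:R - n%:R * msg_lim k.+1) ^+ 2) <=
  (2 * (1 + 2 * (influence n p k.+1 * n%:R) + B) + 2 * r%:R ^+ 2) * n%:R.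
Proof.
move=> B0 Sr HB; set f := msg_lim k.+1; have P0 G := gnnp_ge0 G sparse01.
have /andP[f0 f1] : 0 <= f <= 1 := msg_lim01 k.+1.
have n1 : 1 <= n%:R :> R by rewrite ler1n; move: n0; rewrite ltr0n.
pose m G y : bool := msg k.+1 G (S :\ (b, y)) b y.
pose a G y : R := ((b, y) \in S)%:R * ((m G y)%:R - f).
have a1 G y : `|a G y| <= 1.
  rewrite /a ler_norml; case: (_ \in S); case: (m G y); rewrite /=; lra.
(* [q] counts the vertices of side [b] missing from [S]; they shift the centered count by [q * f],
   which is at most [r]. *)
pose q := \sum_(y < n) ((b, y) \notin S)%:R : R.
have qr : 0 <= q <= r%:R.
  rewrite sumr_ge0 //= /q -natr_sum ler_nat; apply: leq_trans Sr.
  have pinj : injective (fun y : 'I_n => (b, y)) by move=> y z [].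
  rewrite -big_mkcond sum1_card -(card_imset _ pinj); apply: subset_leq_card.
  by apply/subsetP => _ /imsetP[y + ->]; rewrite inE.
have aliveE G : #|alive k.+1 G S b|%:R - n%:R * f = \sum_y a G y - q * f.
  rewrite -sum1_card big_mkcond /= natr_sum /q mulr_suml -sumrB.
  rewrite (_ : n%:R * f = \sum_(y < n) f); last by rewrite sumr_const card_ord mulr_natl.
  rewrite -sumrB; apply: eq_bigr => y _; rewrite inE /a /m.
  by case: (_ \in S); case: (msg _ _ _ _ _) => /=; lra.
have aa y z : E (fun G => a G y * a G z) <=
    (y == z)%:R + (2 * influence n p k.+1 + B / n%:R).
  have e0 : 0 <= 2 * influence n p k.+1 + B / n%:R.
    by rewrite addr_ge0 ?divr_ge0 // mulr_ge0 // influence_ge0 // sparse01.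
  case: (eqVneq y z) => [<-|yz] /=.
    apply: (@le_trans _ _ (E (fun=> 1))).
      apply: le_expect => // G; move: (a1 G y); rewrite ler_norml => /andP[]; nra.
    by rewrite expect_cst ?gnnp_sum1 // lerDl.
  rewrite add0r.
  case: (boolP ((b, y) \in S)) => yS; last first.
    by rewrite [leLHS]big1 // => G _; rewrite /a (negPf yS) !mul0r mulr0.
  case: (boolP ((b, z) \in S)) => zS; last first.
    by rewrite [leLHS]big1 // => G _; rewrite /a (negPf zS) mul0r !mulr0.
  (* Both messages are compared with their versions in the common set [S'], each at the cost of one
     [influence]; [expect_msg_pair] then applies. *)
  pose S' := S :\ (b, y) :\ (b, z).
  have yzb : (b, y) != (b, z) by rewrite xpair_eqE eqxx.
  have Sy : (b, z) |: S' = S :\ (b, y) by rewrite setD1K // in_setD1 eq_sym yzb.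
  have Sz : (b, y) |: S' = S :\ (b, z).
    have -> : S' = S :\ (b, z) :\ (b, y) by rewrite /S' setDDl setUC -setDDl.
    by rewrite setD1K // in_setD1 yzb.
  have S'r : (#|~: S'| <= r.+2)%N.
    rewrite /S' !setDE !setCI !setCK.
    apply: (leq_trans (leq_card_setU _ _)); rewrite cards1 addn1 ltnS.
    apply: (leq_trans (leq_card_setU _ _)); rewrite cards1 addn1 ltnS //.
  have yS' : (b, y) \notin S' by rewrite !inE eqxx andbF.
  have zS' : (b, z) \notin S' by rewrite !inE eqxx.
  apply: (@le_trans _ _ (E (fun G =>
    ((m G y != msg k.+1 G S' b y)%:R + (m G z != msg k.+1 G S' b z)%:R) +
    ((msg k.+1 G S' b y)%:R - f) * ((msg k.+1 G S' b z)%:R - f)))).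
    apply: le_expect => // G; rewrite /a yS zS !mul1r.
    by case: (m G y); case: (m G z); case: (msg k.+1 G S' b y);
       case: (msg k.+1 G S' b z) => /=; nra.
  rewrite !expectD expect_msg_pair //; apply: lerD; last exact: HB.
  rewrite mulr_natl mulr2n; apply: lerD.
    by rewrite /m -Sy; apply: msg_influence; rewrite ?sparse01 // eq_sym.
  by rewrite /m -Sz; apply: msg_influence; rewrite ?sparse01.
have S2 : E (fun G => (\sum_y a G y) ^+ 2) <=
    (1 + 2 * (influence n p k.+1 * n%:R) + B) * n%:R.
  have -> : E (fun G => (\sum_y a G y) ^+ 2) = \sum_y \sum_z E (fun G => a G y * a G z).
    under [RHS]eq_bigr do rewrite -expect_sum.
    rewrite -expect_sum; apply: eq_expect => G; rewrite expr2 mulr_suml.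
    by apply: eq_bigr => y _; rewrite mulr_sumr.
  apply: (@le_trans _ _ (\sum_(y < n) \sum_(z < n)
      ((y == z)%:R + (2 * influence n p k.+1 + B / n%:R)))).
    by apply: ler_sum => y _; apply: ler_sum => z _; exact: aa.
  have -> : \sum_(y < n) \sum_(z < n)
      ((y == z)%:R + (2 * influence n p k.+1 + B / n%:R)) =
      \sum_(y < n) (1 + n%:R * (2 * influence n p k.+1 + B / n%:R)).
    apply: eq_bigr => y _; rewrite big_split /= sumr_const card_ord [in RHS]mulr_natl.
    congr (_ + _); rewrite (bigD1 y) //= eqxx big1 ?addr0 // => z zy.
    by rewrite eq_sym (negPf zy).
  rewrite sumr_const card_ord -[leLHS]mulr_natl le_eqVlt; apply/orP; left.
  by apply/eqP; field; rewrite gt_eqF.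
apply: (@le_trans _ _ (E (fun G => 2 * (\sum_y a G y) ^+ 2 + 2 * r%:R ^+ 2))).
  apply: le_expect => // G; rewrite aliveE; set A := \sum_y _.
  have qf : 0 <= q * f <= r%:R by nra.
  have : (q * f) ^+ 2 <= r%:R ^+ 2 by rewrite lerXn2r ?nnegrE //; lra.
  have : 0 <= (A + q * f) ^+ 2 by exact: sqr_ge0.
  by rewrite !expr2; nra.
rewrite expectD expectZ expect_cst ?gnnp_sum1 //.
have : r%:R ^+ 2 <= r%:R ^+ 2 * n%:R :> R by rewrite ler_peMr ?sqr_ge0.
by move: S2; lra.
Qed.

End FixedSize.

(** The induction on [k] must hold for all [r], since each depth removes two more vertices, and [C]
    must be uniform in [n], [S] and [b]. *)
Lemma alive_concentration k r : exists2 C : R, 0 <= C &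
  forall n, c <= n%:R -> forall (S : {set bool * 'I_n}) b, (#|~: S| <= r)%N ->
  expect (gnnp (c / n%:R))
    (fun G => (#|alive k G S b|%:R - n%:R * msg_lim k) ^+ 2) <= C * n%:R.
Proof.
elim: k r => [|k IH] r.
  exists 0 => // n _ S b _; rewrite mul0r [leLHS]big1 // => G _.
  have -> : alive 0 G S b = set0 by apply/setP => y; rewrite !inE andbF.
  by rewrite cards0 mulr0 subrr expr0n mulr0.
have [C C0 HC] := IH r.+2.
have [D HD] : exists D : R, forall n, 0 < n%:R :> R ->
    influence n (c / n%:R) k.+1 * n%:R <= D.
  elim: k.+1 => [|l [D HD]]; first by exists 0 => n _ /=; rewrite mul0r.
  exists (c + c * D) => n n0 /=.
  have -> : (c / n%:R + n%:R * (c / n%:R) * influence n (c / n%:R) l) * n%:R =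
     c + c * (influence n (c / n%:R) l * n%:R) by field; rewrite gt_eqF.
  by rewrite lerD2l ler_pM2l // HD.
pose B := 2 * c ^+ 4 + 2 * c ^+ 2 * C.
have B0 : 0 <= B by have c0W := ltW c0; rewrite addr_ge0 ?mulr_ge0 ?exprn_ge0.
(* The sign of [D] is unknown, so the maximum with 0 secures nonnegativity. *)
exists (Num.max 0 (2 * (1 + 2 * D + B) + 2 * r%:R ^+ 2)).
  by rewrite le_max lexx.
move=> n cn S b Sr; have n0 : 0 < n%:R :> R by exact: lt_le_trans cn.
apply: (le_trans (alive_second_moment cn B0 Sr _)).
  by move=> S' S'r; apply: expect_pow_msg_lim => //; exact: HC.
rewrite ler_pM2r // le_max; apply/orP; right.
by have := HD n n0; lra.
Qed.

End Concentration.

(** * Cover bound on the maximum matching for edge probability [c / n] *)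

Section SparseMaxMatching.
Variables (R : realType) (c : R).
Hypothesis c0 : 0 < c.

(** The function [(1 + u) exp (- u)] decreases for [u >= 0], so only [z > y] costs anything; there
    its slope [- u exp (- u)] has size at most [c]. *)
Lemma dist_oneD_expRN (y z : R) : 0 <= y -> 0 <= z <= c ->
  (1 + y) * expR (- y) - c * `|z - y| <= (1 + z) * expR (- z).
Proof.
move=> y0 /andP[z0 zc]; have := expR_ge0 (- z); have := expR_ge0 (- y) => ey ez.
case/orP: (le_total z y) => h.
  rewrite ler0_norm ?subr_le0 //.
  have -> : expR (- z) = expR (- y) * expR (y - z) by rewrite -expRD; congr expR; ring.
  have e1 : 1 + (y - z) <= expR (y - z) by exact: expR_ge1Dx.
  have e2 : 1 + y <= (1 + z) * expR (y - z) by nra.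
  have : 0 <= c * - (z - y) by rewrite mulr_ge0 ?(ltW c0) //; lra.
  by nra.
rewrite ger0_norm ?subr_ge0 //.
have -> : expR (- z) = expR (- y) * expR (- (z - y)) by rewrite -expRD; congr expR; ring.
have e1 : 1 - (z - y) <= expR (- (z - y)) by have := expR_ge1Dx (- (z - y)); lra.
have ey1 : expR (- y) <= 1 by rewrite expR_le1; lra.
have e2 : (1 + y) - z * (z - y) <= (1 + z) * expR (- (z - y)) by nra.
have e3 : z * (z - y) <= c * (z - y) by rewrite ler_wpM2r ?subr_ge0.
have : 0 <= z * (z - y) by rewrite mulr_ge0 ?subr_ge0.
by nra.
Qed.

(** Bounds a first absolute moment by a second moment, with a free parameter [eta] in place of the
    Cauchy-Schwarz inequality. *)
Lemma ler_norm_AMGM (eta x : R) : 0 < eta -> `|x| <= eta + x ^+ 2 / eta.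
Proof.
move=> e0; rewrite -(ler_pM2r e0) mulrDl mulfVK ?gt_eqF //.
have := sqr_ge0 (`|x| - eta); have := real_normK (num_real x).
have := normr_ge0 x; rewrite !expr2; nra.
Qed.

(** The bound is the expected size of the cover: a bin belongs to it with probability about
    [1 - f_(k+2)], and a ball with about the probability that a Poisson variable of mean [c f_k] is
    at least 2. Terms of order [1 / n] per vertex are collected in [K]. *)
Lemma expected_max_matching_sparse k (eta : R) : odd k -> 0 < eta ->
  exists K, forall n, c <= n%:R ->
  expected_max_matching n (c / n%:R) <=
  n%:R * (2 - msg_lim c k.+2 - (1 + c * msg_lim c k) * expR (- (c * msg_lim c k)) +
          (1 + c ^+ 2) * eta) + K.
Proof.
move=> ok e0.
have [C1 C10 H1] := alive_concentration c0 k.+1 1.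
have [C2 C20 H2] := alive_concentration c0 k 1.
pose B := 2 * c ^+ 4 + 2 * c ^+ 2 * C1.
pose K1 := B / eta; pose K2 := c ^+ 2 * C2 / eta + c ^+ 2 * (1 + c).
exists (K1 + K2) => n cn; set y := c * msg_lim c k.
have n0 : 0 < n%:R :> R by exact: lt_le_trans cn.
set p := c / n%:R; have p01 : 0 <= p <= 1 := sparse01 c0 cn.
have P0 G : 0 <= @gnnp R n p G := gnnp_ge0 G p01.
pose E := expect (@gnnp R n p).
have cst a : E (fun=> a) = a by exact: expect_cst (gnnp_sum1 _ _) _.
have c1 (v : bool * 'I_n) : (#|~: [set~ v]| <= 1)%N by rewrite setCK cards1.
(* Probability that a bin stays outside the cover. *)
have free i : msg_lim c k.+2 - eta - K1 / n%:R <=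
    E (fun G => (msg k.+2 G [set~ (true, i)] true i)%:R).
  have -> : E (fun G => (msg k.+2 G [set~ (true, i)] true i)%:R) =
      E (fun G => (1 - p) ^+ #|alive k.+1 G [set~ (true, i)] false|).
    transitivity (E (fun G => (msg k.+2 G [set~ (true, i)] true i)%:R * 1)).
      by apply: eq_expect => G; rewrite mulr1.
    rewrite /E expect_msg //; last by rewrite !inE eqxx.
    by apply: eq_expect => G; rewrite mulr1.
  pose Y (G : bigraph n) :=
    (1 - p) ^+ #|alive k.+1 G [set~ (true, i)] false| - msg_lim c k.+2.
  have HY : E (fun G => Y G ^+ 2) <= B / n%:R.
    exact: (expect_pow_msg_lim c0 cn (H1 n cn _ false (c1 (true, i)))).
  have : E (fun G => (msg_lim c k.+2 - eta) - eta^-1 * Y G ^+ 2) <=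
     E (fun G => (1 - p) ^+ #|alive k.+1 G [set~ (true, i)] false|).
    apply: le_expect => // G; have := ler_norm_AMGM (Y G) e0.
    have := ler_norm (- Y G); rewrite normrN /Y; lra.
  rewrite /E expectB expectZ -/E cst; apply: le_trans.
  have -> : K1 / n%:R = eta^-1 * (B / n%:R) by rewrite /K1; ring.
  rewrite lerD2l lerN2 ler_wpM2l //.
  by rewrite invr_ge0 ltW.
(* Probability that a ball stays outside the cover, from [expect_star1] and the concentration of the
   alive count at depth [k]. *)
have single j : (1 + y) * expR (- y) - c ^+ 2 * eta - K2 / n%:R <=
    E (fun G => (#|[set i in alive k G [set~ (false, j)] true
                   | edge false j i \in G]| <= 1)%N%:R).
  have jS : (false, j) \notin [set~ (false, j)] by rewrite !inE eqxx.
  apply: le_trans (expect_star1 p01 (alive_star_free k true jS)).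
  pose D (G : bigraph n) := #|alive k G [set~ (false, j)] true|%:R - n%:R * msg_lim c k.
  have HD : E (fun G => D G ^+ 2) <= C2 * n%:R := H2 n cn _ true (c1 (false, j)).
  have : E (fun G => ((1 + y) * expR (- y) - c ^+ 2 * eta - c ^+ 2 * (1 + c) / n%:R) -
       c ^+ 2 / (eta * n%:R ^+ 2) * D G ^+ 2) <=
    E (fun G => (1 - p) ^+ #|alive k G [set~ (false, j)] true| *
                (1 + p * #|alive k G [set~ (false, j)] true|%:R)).
    apply: le_expect => // G; rewrite /D; set U := #|_|.
    have Un : (U <= n)%N by exact: alive_le.
    set f := msg_lim c k in y *; have f0 : 0 <= f by case/andP: (msg_lim01 c0 k).
    set d := U%:R - n%:R * f.
    have z0 : 0 <= p * U%:R <= c.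
      rewrite mulr_ge0 //; last by case/andP: p01.
      by rewrite /p mulrAC ler_pdivrMr // ler_pM2l // ler_nat.
    have y0 : 0 <= y by rewrite mulr_ge0 // ltW.
    have := dist_oneD_expRN y0 z0.
    have -> : p * U%:R - y = c * (d / n%:R).
      by rewrite /p /y /d; field; rewrite gt_eqF.
    rewrite normrM (gtr0_norm c0).
    have /andP[_ ] := expR_onem U p01.
    have : U%:R * p ^+ 2 <= c ^+ 2 / n%:R.
      apply: (@le_trans _ _ (n%:R * p ^+ 2)).
        by rewrite ler_wpM2r ?sqr_ge0 ?ler_nat.
      by rewrite /p le_eqVlt; apply/orP; left; apply/eqP; field; rewrite gt_eqF.
    have := ler_norm_AMGM (d / n%:R) e0.
    have -> : (d / n%:R) ^+ 2 / eta = d ^+ 2 / (eta * n%:R ^+ 2).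
      by field; rewrite !gt_eqF.
    have -> : c ^+ 2 / (eta * n%:R ^+ 2) * d ^+ 2 = c ^+ 2 * (d ^+ 2 / (eta * n%:R ^+ 2)) by ring.
    have -> : c ^+ 2 * (1 + c) / n%:R = (c ^+ 2 / n%:R) * (1 + c) by ring.
    set q := (1 - p) ^+ U; set w := d ^+ 2 / _; set nd := `|d / n%:R|.
    set e := expR (- (p * U%:R)); set u := U%:R * p ^+ 2; set g := c ^+ 2 / n%:R.
    set z := p * U%:R in z0 *; set ey := (1 + y) * _ => h1 h2 h3 h4.
    have h5 : c * (c * nd) <= c ^+ 2 * eta + c ^+ 2 * w.
      by rewrite mulrA -expr2 -mulrDr ler_wpM2l ?sqr_ge0.
    have g0 : 0 <= g by rewrite divr_ge0 ?sqr_ge0 ?ltW.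
    have h6 : (1 + z) * e <= (1 + z) * q + (1 + c) * g by nra.
    by rewrite [q * _]mulrC; lra.
  rewrite /E expectB expectZ -/E cst; apply: le_trans.
  rewrite (_ : K2 / n%:R = c ^+ 2 * (1 + c) / n%:R + c ^+ 2 / (eta * n%:R ^+ 2) * (C2 * n%:R)).
    rewrite opprD addrA lerD2l lerN2 ler_wpM2l //.
    by rewrite divr_ge0 ?sqr_ge0 // mulr_ge0 ?sqr_ge0 // ltW.
  by rewrite /K2; field; rewrite !gt_eqF.
apply: (@le_trans _ _ (E (fun G => \sum_(i < n) (1 - (msg k.+2 G [set~ (true, i)] true i)%:R) +
   \sum_(j < n) (1 - (#|[set i in alive k G [set~ (false, j)] true
                   | edge false j i \in G]| <= 1)%N%:R)))).
  apply: le_expect => // G.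
  have := matching_le_cover (fun i j => @edge_covered n k G i j ok).
  rewrite -(ler_nat R) natrD; move/le_trans; apply.
  have cardE (A : {set 'I_n}) : #|A|%:R = \sum_i (i \in A)%:R :> R.
    by rewrite -sum1_card big_mkcond natr_sum.
  rewrite !cardE; apply: lerD; apply: ler_sum => i _.
    by rewrite inE; case: (msg _ _ _ _ _); rewrite /= ?subrr ?subr0.
  by rewrite inE ltnNge; case: (_ <= 1)%N; rewrite /= ?subrr ?subr0.
rewrite /E expectD !expect_sum -/E.
apply: (@le_trans _ _ (\sum_(i < n) (1 - (msg_lim c k.+2 - eta - K1 / n%:R)) +
   \sum_(j < n) (1 - ((1 + y) * expR (- y) - c ^+ 2 * eta - K2 / n%:R)))).
  by apply: lerD; apply: ler_sum => i _; rewrite /E expectB -/E cst lerD2l lerN2.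
rewrite !sumr_const !card_ord -[X in X + _]mulr_natl -[X in _ + X]mulr_natl.
have nK (K : R) : n%:R * (K / n%:R) = K by rewrite mulrC divfK ?gt_eqF.
rewrite -[X in _ <= _ + (X + _)]nK -[X in _ <= _ + (_ + X)]nK.
by rewrite -!mulrDr ler_pM2l //; lra.
Qed.

End SparseMaxMatching.

(** * The expected size of the oblivious matching *)

Section ObliviousMatching.
Variable n : nat.
Implicit Types (G M : bigraph n) (w : picks n) (i j : 'I_n).

Definition picked w : {set 'I_n} := [set i | [exists j, w j == Some i]].

Lemma bin_matchedU1 M i j i' :
  bin_matched ((i, j) |: M) i' = (i' == i) || bin_matched M i'.
Proof.
apply/existsP/idP => [[j']|/orP[/eqP ->|/existsP[j' h]]].
- rewrite in_setU1 => /orP[/eqP[-> _]|h]; first by rewrite eqxx.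
  by apply/orP; right; apply/existsP; exists j'.
- by exists j; rewrite setU11.
- by exists j'; rewrite in_setU1 h orbT.
Qed.

(** Invariant of the run over every prefix of arrivals. A pick fails only at a bin already taken, so
    a bin is matched as soon as some ball has picked it; hence the final size is the number of
    picked bins. *)
Lemma foldl_obliviousP w (s : seq 'I_n) :
  let M := foldl (oblivious_step w) set0 s in
  [/\ forall e, e \in M -> w e.2 = Some e.1,
      forall i, bin_matched M i = has (fun j => w j == Some i) s &
      forall e f, e \in M -> f \in M -> e.1 = f.1 -> e = f].
Proof.
elim/last_ind: s => [|s j [IHw IHb IHi]].
  split=> [e|i|e f]; rewrite ?inE //.
  by apply/existsP => -[j]; rewrite inE.
rewrite foldl_rcons /=; set M := foldl _ _ s in IHw IHb IHi *.
rewrite /oblivious_step; case wj: (w j) => [i|]; last first.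
  split=> // i; rewrite IHb has_rcons wj //.
case: ifP => Mi.
  split=> // i'; rewrite IHb has_rcons wj.
  by case: eqP => // -[<-]; rewrite -IHb Mi.
split=> [e|i'|e f].
- by rewrite in_setU1 => /orP[/eqP ->|/IHw].
- rewrite bin_matchedU1 IHb has_rcons wj; congr (_ || _).
  by rewrite eq_sym; apply/eqP/eqP => [->|[]].
- have Mi' g : g \in M -> g.1 <> i.
    move=> gM gi; suff : bin_matched M i by rewrite Mi.
    by apply/existsP; exists g.2; rewrite -gi -surjective_pairing.
  rewrite !in_setU1 => /orP[/eqP ->|eM] /orP[/eqP ->|fM] //= h.
  + by case: (Mi' f fM).
  + by case: (Mi' e eM).
  + exact: IHi.
Qed.

Lemma oblivious_sizeE w : oblivious_size w = #|picked w|.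
Proof.
have [_ Hb Hi] := foldl_obliviousP w (enum 'I_n).
rewrite /oblivious_size /oblivious_matching; set M := foldl _ _ _ in Hb Hi *.
rewrite -(card_in_imset (f := fst)); last by move=> e f; exact: Hi.
apply: eq_card => i; transitivity (bin_matched M i).
  apply/imsetP/existsP => [[[i' j] eM /= ->]|[j h]]; first by exists j.
  by exists (i, j).
rewrite Hb inE; apply/hasP/existsP => [[j _ h]|[j h]]; exists j => //.
by rewrite mem_enum.
Qed.

Lemma oblivious_size_le_max G w :
  (forall i j, w j = Some i -> (i, j) \in G) ->
  (oblivious_size w <= max_matching_size G)%N.
Proof.
move=> wG; have [Hw _ Hi] := foldl_obliviousP w (enum 'I_n).
apply: (@leq_bigmax_cond _ _ (fun M : bigraph n => #|M|) (oblivious_matching w)).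
apply/andP; split; first by apply/subsetP => -[i j] /Hw/wG.
apply/forall_inP => e eM; apply/forall_inP => f fM; apply/implyP.
case/orP => /eqP h; apply/eqP; apply: Hi => //.
by have := Hw e eM; rewrite h Hw // => -[].
Qed.

End ObliviousMatching.

Section ExpectedOblivious.
Variables (R : realType) (n : nat) (p : R).
Implicit Types (G : bigraph n) (w : picks n) (i j : 'I_n) (N : {set 'I_n}).
Local Notation E := (expect (@gnnp R n p)).

Lemma sum_option (F : option 'I_n -> R) :
  \sum_o F o = F None + \sum_i F (Some i).
Proof.
rewrite (bigD1 None) //=; congr (_ + _).
rewrite (reindex_omap Some id) /=; last by case.
by apply: eq_bigl => i; rewrite eqxx.
Qed.

Lemma pick_prob_sum1 G j : \sum_o pick_prob R G j o = 1.
Proof.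
rewrite sum_option /= -big_mkcond /= sumr_const.
case: eqVneq => [->|N0]; first by rewrite cards0 addr0.
by rewrite add0r -[LHS]mulr_natl mulfV // pnatr_eq0 cards_eq0.
Qed.

Lemma pick_prob_ge0 G j o : 0 <= pick_prob R G j o.
Proof. by case: o => [i|] /=; case: ifP => //; rewrite invr_ge0. Qed.

Lemma picks_law_ge0 G w : 0 <= picks_law R G w.
Proof. by apply: prodr_ge0 => j _; exact: pick_prob_ge0. Qed.

Lemma picks_law_sum1 G : \sum_w picks_law R G w = 1.
Proof.
rewrite -(bigA_distr_bigA (fun j o => pick_prob R G j o)).
by apply: big1 => j _; exact: pick_prob_sum1.
Qed.

(** Linearity over the bins: given the graph, the picks are independent, so the probability that a
    bin is never picked is a product over the balls. *)
Lemma expect_oblivious_size G :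
  expect (picks_law R G) (fun w => (oblivious_size w)%:R) =
  \sum_i (1 - \prod_j (1 - pick_prob R G j (Some i))).
Proof.
transitivity (expect (picks_law R G) (fun w => \sum_i (1 - \prod_j (w j != Some i)%:R))).
  apply: eq_expect => w; rewrite oblivious_sizeE -sum1_card big_mkcond natr_sum.
  apply: eq_bigr => i _; rewrite inE; case: (boolP [exists j, _]) => [/existsP[j h]|].
    by rewrite (bigD1 j) //= h mul0r subr0.
  rewrite negb_exists => /forallP h; rewrite big1 ?subrr // => j _.
  by rewrite h.
rewrite expect_sum; apply: eq_bigr => i _.
rewrite expectB expect_cst ?picks_law_sum1 //; congr (_ - _).
transitivity (\sum_(w : picks n) \prod_j (pick_prob R G j (w j) * (w j != Some i)%:R)).
  by apply: eq_bigr => w _; rewrite big_split.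
rewrite -(bigA_distr_bigA (fun j o => pick_prob R G j o * (o != Some i)%:R)).
apply: eq_bigr => j _; rewrite -[X in _ = X - _](pick_prob_sum1 G j) [in RHS](bigD1 (Some i)) //=.
rewrite [X in _ = X - _]addrC addrK [RHS]big_mkcond; apply: eq_bigr => o _.
by case: eqP => _; rewrite /= ?(mulr0, mulr1).
Qed.

Definition column_law N : R := \prod_i (if i \in N then p else 1 - p).

(** A graph is the family of the neighborhoods of its balls, which are independent with law
    [column_law]. *)
Lemma expect_columns (phi : {set 'I_n} -> R) :
  E (fun G => \prod_j phi (nbrs G j)) = (\sum_N column_law N * phi N) ^+ n.
Proof.
transitivity (\prod_(j < n) \sum_N column_law N * phi N); last first.
  by rewrite prodr_const card_ord.
rewrite bigA_distr_bigA /= /expect.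
pose g (f : {ffun 'I_n -> {set 'I_n}}) : bigraph n := [set e | e.1 \in f e.2].
have nbrs_g f j : nbrs (g f) j = f j by apply/setP => i; rewrite !inE.
rewrite (reindex g) /=; last first.
  exists (fun G => [ffun j => nbrs G j]) => [f _|G _].
    by apply/ffunP => j; rewrite ffunE nbrs_g.
  by apply/setP => -[i j]; rewrite !inE ffunE inE.
apply: eq_bigr => f _; rewrite big_split /=; congr (_ * _).
  transitivity (\prod_(j < n) \prod_(i < n) (if (i, j) \in g f then p else 1 - p)).
    by rewrite exchange_big pair_bigA; apply: eq_bigr => -[i j].
  by apply: eq_bigr => j _; apply: eq_bigr => i _; rewrite inE.
by apply: eq_bigr => j _; rewrite nbrs_g.
Qed.

Lemma column_lawE N : column_law N = p ^+ #|N| * (1 - p) ^+ (n - #|N|).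
Proof.
have -> : (n - #|N|)%N = #|~: N| by rewrite [RHS]cardsCs setCK card_ord.
rewrite /column_law (bigID (mem N)) /=.
rewrite -!prodr_const; congr (_ * _).
  by apply: eq_bigr => i ->.
by apply: eq_big => [i|i /negPf ->] //; rewrite inE.
Qed.

Lemma column_law_sum1 : \sum_N column_law N = 1.
Proof.
transitivity (\prod_(i < n) (p + (1 - p))).
  by rewrite bigA_distr; apply: eq_big => // N; rewrite inE.
by apply: big1 => i _; rewrite addrC subrK.
Qed.

(* By symmetry all bins are picked equally often, and a ball picks some bin
   unless its neighborhood is empty. *)
Lemma column_pick i :
  \sum_N column_law N * (if i \in N then #|N|%:R^-1 else 0) =
  (1 - (1 - p) ^+ n) / n%:R.
Proof.
pose h i := \sum_N column_law N * (if i \in N then #|N|%:R^-1 else 0).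
have hE i' : h i' = h i.
  rewrite /h (reindex_inj (imset_inj (@perm_inj _ (tperm i i')))) /=.
  apply: eq_bigr => N _; rewrite !column_lawE !card_imset; try exact: perm_inj.
  by rewrite -[X in X \in _ @: _](tpermL i i') mem_imset //; exact: perm_inj.
have n0 : n%:R != 0 :> R by rewrite pnatr_eq0 -lt0n (leq_ltn_trans _ (ltn_ord i)).
have : \sum_i' h i' = 1 - (1 - p) ^+ n.
  rewrite exchange_big /= -[X in _ = X - _]column_law_sum1.
  rewrite [in RHS](bigD1 finset.set0) //= [LHS](bigD1 finset.set0) //=.
  rewrite column_lawE cards0 expr0 mul1r subn0 [X in _ = X - _]addrC addrK.
  rewrite big1 ?add0r; last by move=> i' _; rewrite inE mulr0.
  apply: eq_bigr => N N0; rewrite -mulr_sumr -big_mkcond /= sumr_const.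
  by rewrite -[X in _ * X]mulr_natl mulfV ?mulr1 // pnatr_eq0 cards_eq0.
under eq_bigr do rewrite hE.
by rewrite sumr_const card_ord -[LHS]mulr_natl => <-; rewrite mulrAC mulfV // mul1r.
Qed.

Lemma expected_obliviousE : expected_oblivious n p =
  n%:R * (1 - (1 - (1 - (1 - p) ^+ n) / n%:R) ^+ n).
Proof.
rewrite /expected_oblivious.
transitivity (E (fun G => \sum_i (1 - \prod_j (1 - pick_prob R G j (Some i))))).
  by apply: eq_expect => G; rewrite expect_oblivious_size.
rewrite expect_sum.
transitivity (\sum_(i < n) (1 - (1 - (1 - (1 - p) ^+ n) / n%:R) ^+ n)); last first.
  by rewrite sumr_const card_ord mulr_natl.
apply: eq_bigr => i _; rewrite expectB expect_cst ?gnnp_sum1 //; congr (_ - _).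
rewrite (expect_columns (fun N => 1 - (if i \in N then #|N|%:R^-1 else 0))).
congr (_ ^+ _); under eq_bigr do rewrite mulrBr mulr1.
by rewrite sumrB column_law_sum1 column_pick.
Qed.

Hypothesis p01 : 0 <= p <= 1.

Lemma expected_oblivious_le_max : expected_oblivious n p <= expected_max_matching n p.
Proof.
apply: le_expect => [G|G]; first exact: gnnp_ge0.
rewrite -[leRHS](expect_cst (picks_law_sum1 G)).
(* Picks of nonzero weight use only edges of [G], so their matching is a matching of [G]. *)
apply: ler_sum => w _; case: (eqVneq (picks_law R G w) 0) => [->|law0].
  by rewrite !mul0r.
rewrite ler_wpM2l ?picks_law_ge0 // ler_nat; apply: oblivious_size_le_max => i j wj.
move/prodf_neq0: law0 => /(_ j isT); rewrite wj /= inE.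
by case: (_ \in G); rewrite // eqxx.
Qed.

(** The non-isolated balls form a vertex cover. *)
Lemma expected_max_le_nonisolated :
  expected_max_matching n p <= n%:R * (1 - (1 - p) ^+ n).
Proof.
have P0 G := gnnp_ge0 G p01.
pose none j G := [forall i in [set: 'I_n], edge false j i \notin G].
apply: (@le_trans _ _ (E (fun G => \sum_(j < n) (1 - (none j G)%:R)))).
  apply: le_expect => // G.
  have := @matching_le_cover n G finset.set0 [set j | ~~ none j G] _.
  rewrite cards0 add0n -(ler_nat R) => /(_ _)/le_trans; apply.
    move=> i j ijG; rewrite !inE; apply/forall_inPn; exists i => //.
    by rewrite negbK.
  rewrite -sum1_card big_mkcond natr_sum; apply: ler_sum => j _; rewrite inE.
  by case: (none j G); rewrite /= ?subrr ?subr0.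
rewrite expect_sum (eq_bigr (fun=> 1 - (1 - p) ^+ n)).
  by rewrite sumr_const card_ord mulr_natl.
move=> j _; rewrite expectB expect_cst ?gnnp_sum1 //; congr (_ - _).
transitivity (E (fun G => (none j G)%:R * 1)); first by apply: eq_expect => G; rewrite mulr1.
rewrite (@expect_star0 _ _ _ false j (fun=> [set: 'I_n])) //.
under eq_expect do rewrite mulr1 cardsT card_ord.
by rewrite expect_cst ?gnnp_sum1.
Qed.

End ExpectedOblivious.

(** * Dense graphs have almost perfect matchings *)

Section DenseMaxMatching.
Variables (R : realType) (n : nat) (p : R).
Hypothesis p01 : 0 <= p <= 1.
Implicit Types (G : bigraph n) (A B : {set 'I_n}).
Local Notation E := (expect (@gnnp R n p)).

Lemma max_matching_le G : (max_matching_size G <= n)%N.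
Proof.
have := @matching_le_cover n G [set: 'I_n] set0 _.
by rewrite cards0 addn0 cardsT card_ord; apply => i j _; rewrite inE.
Qed.

(** [A] and [B] are the vertices missed by a maximum matching; an edge between them would enlarge
    it. *)
Lemma unmatched_no_edge G : exists A B,
  [/\ #|A| = (n - max_matching_size G)%N, #|B| = (n - max_matching_size G)%N &
      [disjoint setX A B & G]].
Proof.
have m0 : is_matching G set0.
  by rewrite /is_matching sub0set; apply/forall_inP => e; rewrite inE.
have [M /andP[MG Mi] MM] : {M : bigraph n | is_matching G M & max_matching_size G = #|M|}.
  have /(eq_bigmax_cond (fun M : bigraph n => #|M|))[M mM MM] :
    (0 < #|[pred M | is_matching G M]|)%N by apply/card_gt0P; exists set0.
  by exists M.
have inj e f : e \in M -> f \in M -> (e.1 == f.1) || (e.2 == f.2) -> e = f.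
  by move=> eM fM h; move/forall_inP: Mi => /(_ e eM)/forall_inP/(_ f fM)/implyP/(_ h)/eqP.
exists (~: [set e.1 | e in M]), (~: [set e.2 | e in M]).
have cardC (A : {set 'I_n}) : #|~: A| = (n - #|A|)%N by rewrite cardsCs setCK card_ord.
rewrite !cardC MM; split.
- rewrite card_in_imset // => e f eM fM h; apply: inj => //; by rewrite h eqxx.
- rewrite card_in_imset // => e f eM fM h; apply: inj => //; by rewrite h eqxx orbT.
apply/pred0P => -[i j] /=; apply/negbTE/negP => /andP[].
rewrite !inE /= => /andP[iM jM] ijG.
have ijM : (i, j) \notin M.
  by apply: contra iM => h; apply/imsetP; exists (i, j).
suff : is_matching G ((i, j) |: M).
  move=> h; have := @leq_bigmax_cond _ (is_matching G) (fun M : bigraph n => #|M|) _ h.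
  by rewrite -/(max_matching_size G) MM cardsU1 ijM ltnn.
apply/andP; split; first by rewrite subUset sub1set ijG MG.
have new e : e \in M -> ~~ ((e.1 == i) || (e.2 == j)).
  move=> eM; rewrite negb_or; apply/andP; split.
    by apply: contra iM => /eqP <-; apply: imset_f.
  by apply: contra jM => /eqP <-; apply: imset_f.
apply/forall_inP => e; rewrite in_setU1 => /orP[/eqP ->|eM];
  apply/forall_inP => f; rewrite in_setU1 => /orP[/eqP ->|fM]; apply/implyP => //=.
- by rewrite ![_ == f.1]eq_sym ![_ == f.2]eq_sym (negPf (new f fM)).
- by rewrite (negPf (new e eM)).
- by move=> h; apply/eqP; apply: inj.
Qed.

Lemma expect_no_edge (D : {set 'I_n * 'I_n}) :
  E (fun G => [disjoint D & G]%:R) = (1 - p) ^+ #|D|.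
Proof.
transitivity (E (fun G => \prod_(e <- enum D) (1 + -1 * (id e \in G)%:R) * 1)).
  apply: eq_expect => G; rewrite mulr1 big_enum /=.
  case: (boolP [disjoint D & G]) => [/pred0P h|].
    by rewrite big1 // => e eD; have /= := h e; rewrite eD /= => ->; rewrite mulr0 addr0.
  by case/pred0Pn => e /= /andP[eD eG]; rewrite (bigD1 e) //= eG mulr1 subrr mul0r.
rewrite (@expect_edges _ _ p _ id (enum D) (fun _ _ => 1) (fun _ _ => -1)) ?enum_uniq //.
under eq_expect do rewrite mulr1 big_enum /= prodr_const mulrN1.
by rewrite expect_cst ?gnnp_sum1.
Qed.

(** A deficit of at least [eps n] yields two sets of that size spanning no edge. A given pair does
    so with probability at most [exp (- p eps^2 n^2) <= exp (- 3 n)], and there are at most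
    [4^n <= exp (2 n)] pairs. *)
Lemma expected_max_matching_dense (eps : R) : 0 < eps ->
  3 <= n%:R * p * eps ^+ 2 ->
  n%:R * (1 - eps - expR (- n%:R)) <= expected_max_matching n p.
Proof.
move=> e0 np; have P0 G := gnnp_ge0 G p01; have p0 : 0 <= p by case/andP: p01.
pose big A B := (eps * n%:R <= #|A|%:R) && (eps * n%:R <= #|B|%:R).
have H : E (fun G => n%:R - (max_matching_size G)%:R) <=
   E (fun G => eps * n%:R + n%:R * \sum_A \sum_(B | big A B) [disjoint setX A B & G]%:R).
  apply: le_expect => // G.
  have [A [B [cA cB AB]]] := unmatched_no_edge G.
  have dn : n%:R - (max_matching_size G)%:R = #|A|%:R :> R.
    by rewrite cA natrB // max_matching_le.
  have s0 : 0 <= \sum_A \sum_(B | big A B) [disjoint setX A B & G]%:R :> R.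
    by apply: sumr_ge0 => ? _; apply: sumr_ge0.
  rewrite dn; case: (leP (eps * n%:R) #|A|%:R) => hA; last first.
    by rewrite (le_trans (ltW hA)) // lerDl mulr_ge0.
  have s1 : 1 <= \sum_A \sum_(B | big A B) [disjoint setX A B & G]%:R :> R.
    rewrite (bigD1 A) //= (bigD1 B) /=; last by rewrite /big hA cB -cA hA.
    rewrite AB -addrA lerDl addr_ge0 //; first by apply: sumr_ge0.
    by apply: sumr_ge0 => ? _; apply: sumr_ge0.
  apply: (@le_trans _ _ n%:R).
    by rewrite ler_nat -[leqRHS]card_ord max_card.
  apply: (@le_trans _ _ (n%:R * \sum_A \sum_(B | big A B) [disjoint setX A B & G]%:R)).
    by rewrite ler_peMr.
  by rewrite lerDr mulr_ge0 // ltW.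
move: H; rewrite expectB expectD !expect_cst ?gnnp_sum1 // expectZ expect_sum.
under eq_bigr do rewrite expect_sum.
have S : \sum_A \sum_(B | big A B) E (fun G => [disjoint setX A B & G]%:R) <=
    expR (- n%:R).
  apply: (@le_trans _ _ (\sum_(A : {set 'I_n}) \sum_(B : {set 'I_n}) expR (- (3 * n%:R)))).
    apply: ler_sum => A _; rewrite big_mkcond; apply: ler_sum => B _.
    case: ifP => [/andP[hA hB]|_]; last exact: expR_ge0.
    rewrite expect_no_edge cardsX.
    have /andP[/le_trans le1 _] := expR_onem (#|A| * #|B|) p01; apply: le1.
    rewrite ler_expR lerN2 natrM.
    have en : 0 <= eps * n%:R by rewrite mulr_ge0 // ltW.
    have h2 : (eps * n%:R) * (eps * n%:R) <= #|A|%:R * #|B|%:R by rewrite ler_pM.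
    apply: (@le_trans _ _ (p * ((eps * n%:R) * (eps * n%:R)))); last by rewrite ler_wpM2l.
    have -> : p * (eps * n%:R * (eps * n%:R)) = (n%:R * p * eps ^+ 2) * n%:R by ring.
    by rewrite ler_wpM2r.
  rewrite !sumr_const -mulrnA.
  have -> : #|{: {set 'I_n}}| = (2 ^ n)%N.
    by rewrite -cardsT -powersetT card_powerset cardsT card_ord.
  have e2 : 2 <= expR 1 :> R by have := expR_ge1Dx (1 : R); lra.
  have e2n : 2 ^+ n <= expR n%:R :> R.
    by rewrite -[n%:R]mul1r expRM_natr lerXn2r ?nnegrE ?expR_ge0.
  rewrite -[leLHS]mulr_natl natrM natrX.
  have -> : - n%:R = n%:R + n%:R + - (3 * n%:R) :> R by ring.
  rewrite !expRD ler_wpM2r ?expR_ge0 // ler_pM ?exprn_ge0 //.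
rewrite -/(expected_max_matching n p) => H.
have : n%:R * \sum_A \sum_(B | big A B) E (fun G => [disjoint setX A B & G]%:R) <=
   n%:R * expR (- n%:R) by rewrite ler_wpM2l.
by move: H; lra.
Qed.

End DenseMaxMatching.

From mathcomp Require Import all_classical all_reals all_analysis.
Import numFieldNormedType.Exports.
Local Open Scope classical_set_scope.
Local Open Scope ring_scope.

(** * Asymptotics *)

Section ObliviousBounds.
Variables (R : realType) (n : nat) (p : R).
Hypotheses (n0 : (0 < n)%N) (p01 : 0 < p < 1).
Let q := 1 - (1 - p) ^+ n.

Let p01W : 0 <= p <= 1. Proof. by move: p01; lra. Qed.
Let nR : 1 <= n%:R :> R. Proof. by rewrite ler1n. Qed.

Lemma nonisolated_bounds :
  [/\ 0 < q, q <= 1, q <= n%:R * p & 1 - expR (- (p * n%:R)) <= q].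
Proof.
have x0 : 0 <= (1 - p) ^+ n by rewrite exprn_ge0 //; move: p01; lra.
have x1 : (1 - p) ^+ n < 1 by rewrite exprn_ilt1 -?lt0n //; move: p01; lra.
have le : 1 ^+ n - (1 - p) ^+ n <= n%:R * (1 - (1 - p)).
  by apply: lerB_exp => //; move: p01; lra.
have /andP[ub _] := expR_onem n p01W.
rewrite expr1n in le; split; rewrite /q; lra.
Qed.

(** [expR_onem] with probability [q / n] has error [n (q / n)^2], which becomes [q^2] once
    multiplied by [n]. *)
Lemma expected_oblivious_bounds :
  n%:R * (1 - expR (- q)) <= expected_oblivious n p <=
  n%:R * (1 - expR (- q)) + q ^+ 2.
Proof.
have [q0 q1 _ _] := nonisolated_bounds.
have nn0 : n%:R != 0 :> R by rewrite gt_eqF //; move: nR; lra.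
have qn : 0 <= q / n%:R <= 1.
  by rewrite divr_ge0 ?(ltW q0) // ler_pdivrMr ?mul1r ?(le_trans q1) // ltr0n.
rewrite expected_obliviousE -/q.
have := expR_onem n qn; rewrite divfK // => /andP[le1 le2].
apply/andP; split; first by rewrite ler_wpM2l // lerD2l lerN2.
have -> : n%:R * (1 - expR (- q)) + q ^+ 2 =
    n%:R * (1 - (expR (- q) - n%:R * (q / n%:R) ^+ 2)) by field.
by rewrite ler_wpM2l // lerD2l lerN2; lra.
Qed.

Lemma expected_oblivious_gt0 : 0 < expected_oblivious n p.
Proof.
have [q0 _ _ _] := nonisolated_bounds.
have /andP[le _] := expected_oblivious_bounds; apply: lt_le_trans le.
rewrite mulr_gt0 ?ltr0n // subr_gt0 -expR0 ltr_expR; lra.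
Qed.

Lemma expected_max_gt0 : 0 < expected_max_matching n p.
Proof. exact: lt_le_trans expected_oblivious_gt0 (expected_oblivious_le_max _ p01W). Qed.

Lemma expected_max_le_n : expected_max_matching n p <= n%:R.
Proof.
have [_ q1 _ _] := nonisolated_bounds.
apply: (le_trans (expected_max_le_nonisolated _ p01W)); rewrite -/q.
by rewrite ler_piMr.
Qed.

(** OBLIVIOUS gets at least [n (q - q^2)] and the optimum at most [n q], so the ratio is at least
    [1 - q >= 1 - n p]. *)
Lemma dist_ratio_sparse :
  `|1 - expected_oblivious n p / expected_max_matching n p| <= n%:R * p.
Proof.
have [q0 q1 qnp _] := nonisolated_bounds; have m0 := expected_max_gt0.
rewrite ger0_norm; last first.
  by rewrite subr_ge0 ler_pdivrMr // mul1r expected_oblivious_le_max.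
apply: le_trans qnp; rewrite lerBlDr -lerBlDl ler_pdivlMr //.
have /andP[le _] := expected_oblivious_bounds; apply: le_trans le.
have mq : expected_max_matching n p <= n%:R * q := expected_max_le_nonisolated _ p01W.
apply: (@le_trans _ _ ((1 - q) * (n%:R * q))); first by rewrite ler_wpM2l // subr_ge0.
rewrite mulrCA ler_wpM2l //; have := expRN_le (ltW q0); rewrite expr2; lra.
Qed.

(** The hypotheses give [exp (- n) <= d] and [exp (- n p) <= d]. Then [q] is within [d] of 1 and the
    optimum within [2 d n] of [n]. *)
Lemma dist_ratio_dense (d : R) : 0 < d <= 4^-1 ->
  1 <= d * n%:R -> 1 <= d * (n%:R * p) -> 3 <= n%:R * p * d ^+ 2 ->
  `|(1 - (expR 1)^-1) - expected_oblivious n p / expected_max_matching n p| <= 6 * d.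
Proof.
move=> /andP[d0 d4] dn dnp npd.
have [q0 q1 _ qnp] := nonisolated_bounds; have m0 := expected_max_gt0.
have m1 := expected_max_le_n; have m2 := expected_max_matching_dense p01W d0 npd.
have /andP[lo hi] := expected_oblivious_bounds.
rewrite -expRN; have s0 := expR_ge0 (- 1 : R).
have expV (x : R) : 1 <= d * x -> expR (- x) <= d.
  move=> dx; have x0 : 0 < x by rewrite -(pmulr_rgt0 _ d0); lra.
  rewrite expRN -[leRHS]invrK lef_pV2 ?posrE ?invr_gt0 ?expR_gt0 //.
  have := expR_ge1Dx x; have : d^-1 <= x by rewrite -div1r ler_pdivrMr // mulrC.
  by lra.
have expn_le := expV _ dn; have expnp_le := expV _ dnp.
have q1d : 1 - q <= d by move: qnp; rewrite [p * _]mulrC; lra.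
have eq1 : expR (- q) <= expR (- 1) + d.
  have := dist_expRN (ltW q0) ler01; rewrite (ler0_norm (_ : q - 1 <= 0)); last lra.
  by have := ler_norm (expR (- q) - expR (- 1)); lra.
have eq2 : expR (- 1) <= expR (- q) by rewrite ler_expR; lra.
have nR0 : 0 < n%:R :> R by move: nR; lra.
rewrite distrC ler_norml; apply/andP; split.
  rewrite lerBrDr ler_pdivlMr //.
  apply: (@le_trans _ _ ((1 - expR (- q)) * n%:R)); last by rewrite mulrC.
  have le1 : - (6 * d) + (1 - expR (- 1)) <= 1 - expR (- q) by lra.
  have eq0 : 0 <= 1 - expR (- q) by rewrite subr_ge0 expR_le1; lra.
  by apply: (@le_trans _ _ ((1 - expR (- q)) * expected_max_matching n p)); nra.
rewrite lerBlDr ler_pdivrMr //; apply: (le_trans hi).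
set s := expR (- 1) in s0 eq1 eq2 *.
have qq : q ^+ 2 <= d * n%:R by apply: le_trans dn; rewrite expr2; nra.
have md : n%:R * (1 - 2 * d) <= expected_max_matching n p.
  by apply: le_trans m2; rewrite ler_pM2l //; lra.
have s1 : s <= 1 by rewrite expR_le1; lra.
apply: (@le_trans _ _ ((6 * d + (1 - s)) * (n%:R * (1 - 2 * d)))); last first.
  by rewrite ler_wpM2l //; lra.
apply: (@le_trans _ _ (n%:R * (1 - s + d))).
  rewrite [leRHS]mulrDr; apply: lerD; last by rewrite [leRHS]mulrC.
  by rewrite ler_wpM2l //; lra.
(* The difference of the two sides is [d (3 - 12 d + 2 s)], nonnegative because [d <= 1 / 4]. *)
by rewrite mulrCA ler_wpM2l //; nra.
Qed.

Lemma expected_oblivious_ge : n%:R * (1 - expR (expR (- (p * n%:R)) - 1)) <=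
  expected_oblivious n p.
Proof.
have [_ _ _ qnp] := nonisolated_bounds; have /andP[lo _] := expected_oblivious_bounds.
by apply: le_trans lo; rewrite ler_wpM2l // lerD2l lerN2 ler_expR; lra.
Qed.

End ObliviousBounds.

(** * Even-depth message limits and the smallest root *)

Section LeastRoot.
Variables (R : realType) (c : R).
Hypothesis c0 : 0 < c.
Let x t := c * msg_lim c t.*2.
Let h (u : R) := c * expR (- (c * expR (- u))).

Let xS t : x t.+1 = h (x t).
Proof. by rewrite /x doubleS. Qed.

Let h_mono u v : u <= v -> h u <= h v.
Proof.
by move=> uv; rewrite ler_pM2l // ler_expR lerN2 ler_pM2l // ler_expR lerN2.
Qed.

Lemma msg_lim_le_gamma t : x t <= gamma_lo c.
Proof.
have [root_ _] := gamma_loP c0; elim: t => [|t IH].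
  by rewrite /x /= mulr0 root_ mulr_ge0 ?expR_ge0 // ltW.
by rewrite xS root_; exact: h_mono.
Qed.

Lemma msg_lim_incr t : x t <= x t.+1.
Proof.
elim: t => [|t IH]; last by rewrite xS [leRHS]xS; exact: h_mono.
by rewrite xS {1}/x /= mulr0 mulr_ge0 ?expR_ge0 // ltW.
Qed.

(** The orbit [x] of 0 under the increasing map [h] climbs to its supremum, which is a fixed point
    of [h] and so at least the smallest root. The index [t.+1] matches the odd truncation depth
    [t.*2.+1] used afterwards. *)
Lemma msg_lim_gamma (eps : R) : 0 < eps -> exists t, gamma_lo c - eps <= x t.+1.
Proof.
move=> e0; have x0 t : 0 <= x t.
  by rewrite mulr_ge0 ?(ltW c0) //; case/andP: (msg_lim01 c0 t.*2).
pose X : set R := range x; have Xx t : X (x t) by exists t.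
have ubX : has_ubound X by exists (gamma_lo c) => _ [t _ <-]; exact: msg_lim_le_gamma.
have supX : has_sup X by split=> //; exists (x 0).
have x_sup t : x t <= sup X by exact: ub_le_sup.
have sup0 : 0 <= sup X := le_trans (x0 0) (x_sup 0).
have h1 : sup X <= h (sup X).
  apply: ge_sup; first by exists (x 0).
  move=> _ [t _ <-]; apply: (le_trans (msg_lim_incr t)).
  by rewrite xS; exact: h_mono.
have h2 : h (sup X) <= sup X.
  apply/ler_addgt0Pr => e e_gt0.
  (* On nonnegative arguments [h] is Lipschitz with constant [c^2], so this accuracy at [x t] costs
     at most [e] after applying [h]. *)
  have d0 : 0 < e / c ^+ 2 by rewrite divr_gt0 ?exprn_gt0.
  have [_ [t _ <-] xt] := sup_adherent d0 supX.
  have dpos u : 0 <= c * expR (- u) by rewrite mulr_ge0 ?expR_ge0 // ltW.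
  have lip : h (sup X) - h (x t) <= c ^+ 2 * (sup X - x t).
    rewrite -mulrBr expr2 -mulrA ler_pM2l //.
    apply: (le_trans (ler_norm _)); apply: (le_trans (dist_expRN _ _)) => //.
    rewrite -mulrBr normrM gtr0_norm // ler_pM2l //.
    apply: (le_trans (dist_expRN _ _)) => //.
    by rewrite ger0_norm // subr_ge0.
  have := x_sup t.+1; rewrite xS.
  have : c ^+ 2 * (sup X - x t) <= c ^+ 2 * (e / c ^+ 2).
    by rewrite ler_pM2l ?exprn_gt0 //; lra.
  by rewrite [leRHS]mulrC divfK ?gt_eqF ?exprn_gt0 //; lra.
have [_ least] := gamma_loP c0.
have gs : gamma_lo c <= sup X by apply: least; apply/eqP; rewrite eq_le -/(h _) h1 h2.
have [_ [t _ <-] xt] := sup_adherent e0 supX.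
exists t; have := msg_lim_incr t; lra.
Qed.

End LeastRoot.

Lemma expected_max_matching_gamma (R : realType) (c eps : R) : 0 < c -> 0 < eps ->
  \forall n \near \oo, expected_max_matching n (c / n%:R) <=
    n%:R * (2 - (gamma_up c + gamma_lo c + gamma_up c * gamma_lo c) / c + eps).
Proof.
move=> c0 e0; set g := gamma_lo c.
(* A third of [eps] each goes to [eta], to the additive constant [K] and to the truncation depth;
   [d1] is chosen so that [(1 + c) d1 / c = d]. *)
pose d := eps / 3; have d0 : 0 < d by rewrite divr_gt0.
pose d1 := d * c / (1 + c).
have d10 : 0 < d1 by rewrite divr_gt0 ?mulr_gt0 // addr_gt0.
have [t gt] := msg_lim_gamma c0 d10.
have k_odd : odd t.*2.+1 by rewrite /= odd_double.
pose eta := d / (1 + c ^+ 2).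
have c2 : 0 < 1 + c ^+ 2 by rewrite addr_gt0 ?exprn_gt0.
have eta0 : 0 < eta by rewrite divr_gt0.
have [K HK] := expected_max_matching_sparse c0 k_odd eta0.
near=> n.
have cn : c <= n%:R by near: n; exact: nbhs_infty_ger.
have Kn : K / d <= n%:R by near: n; exact: nbhs_infty_ger.
have n0 : 0 < n%:R :> R := lt_le_trans c0 cn.
apply: (le_trans (HK n cn)).
have Knd : K <= n%:R * d by move: Kn; rewrite ler_pdivrMr.
apply: (@le_trans _ _ (n%:R * (2 - msg_lim c t.*2.+3 -
  (1 + c * msg_lim c t.*2.+1) * expR (- (c * msg_lim c t.*2.+1)) + d) + n%:R * d)).
  by apply: lerD => //; rewrite /eta mulrCA mulfV ?gt_eqF // mulr1.
rewrite -mulrDr ler_pM2l //.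
(* The density is now [2 - w - (1 + c v) u]. The odd limits [v] and [w] stay above [exp (- g)], and
   [c u] is close to [g] from below, which suffices for an upper bound. *)
rewrite -[expR (- (c * msg_lim c t.*2.+1))]/(msg_lim c t.*2.+2).
set u := msg_lim c t.*2.+2; set v := msg_lim c t.*2.+1; set w := msg_lim c t.*2.+3.
have vg : expR (- g) <= v by rewrite ler_expR lerN2 msg_lim_le_gamma.
have wg : expR (- g) <= w by rewrite ler_expR lerN2 (msg_lim_le_gamma c0 t.+1).
have u0 : 0 <= u := expR_ge0 _.
rewrite /gamma_up -/g; set e := expR (- g) in vg wg *.
have e1 : 0 <= e <= 1.
  rewrite expR_ge0 expR_le1 oppr_le0 /=.
  by have := msg_lim_le_gamma c0 0; rewrite /= mulr0.
have gu : g / c <= u + d1 / c.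
  rewrite ler_pdivrMr // mulrDl divfK ?gt_eqF // [u * c]mulrC.
  by move: gt; rewrite -/g doubleS -/u; lra.
have d1c : d1 / c = d / (1 + c).
  by rewrite /d1; field; rewrite !gt_eqF // addr_gt0.
have -> : (c * e + g + c * e * g) / c = e + (1 + c * e) * (g / c).
  by field; rewrite gt_eqF.
have ce : 0 <= c * e <= c by nra.
have step1 : (1 + c * e) * (g / c) <= (1 + c * e) * u + d.
  apply: (@le_trans _ _ ((1 + c * e) * (u + d1 / c))); first by rewrite ler_wpM2l //; lra.
  rewrite mulrDr lerD2l d1c mulrCA ler_piMr ?(ltW d0) // ler_pdivrMr ?mul1r; lra.
have step2 : (1 + c * e) * u <= (1 + c * v) * u by rewrite ler_wpM2r // lerD2l ler_pM2l.
have -> : eps = d + d + d by rewrite /d; lra.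
by lra.
Unshelve. all: by end_near. Qed.

(** * Assembly of the three regimes *)

Lemma le_limn_einf (R : realType) (u : nat -> R) (l : R) :
  (forall eps, 0 < eps -> \forall n \near \oo, l - eps <= u n) ->
  (l%:E <= limn_einf (fun n => (u n)%:E))%E.
Proof.
move=> H; apply/lee_addgt0Pr => e e0; rewrite -leeBlDr //.
rewrite limn_einf_lim; apply: lime_ge; first exact: is_cvg_einfs.
have [N _ HN] := H e e0; exists N => // n /= Nn.
apply: le_ereal_inf_tmp => _ [m /= nm <-].
by rewrite lee_fin; apply: HN; apply: leq_trans nm.
Qed.

Theorem theorem2 (R : realType) (p : nat -> R) (hp : valid p) :
  [/\ p =o_\oo (fun n : nat => n%:R^-1 : R) ->
        oblivious_ratio p n @[n --> \oo] --> (1 : R),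
      forall c : R, 0 < c -> (\forall n \near \oo, p n = c / n%:R) ->
        (((c - c * expR (expR (- c) - 1)) /
          (2 * c - (gamma_up c + gamma_lo c + gamma_up c * gamma_lo c)))%:E
         <= limn_einf (fun n => (oblivious_ratio p n)%:E))%E
    & (fun n : nat => (n%:R^-1)%R : R) =o_\oo p ->
        oblivious_ratio p n @[n --> \oo] --> (1 - (expR 1)^-1 : R)].
Proof.
have [p01 _] := hp; split.
- move=> /eqoP small; apply/cvgrPdist_le => e e0; near=> n.
  have n0 : (0 < n)%N by near: n; exact: nbhs_infty_gt.
  have nR : 0 < n%:R :> R by rewrite ltr0n.
  apply: (le_trans (dist_ratio_sparse n0 (p01 n n0))).
  have : `|p n| <= e * `|n%:R^-1 : R| by near: n; exact: small.
  have /andP[pn0 _] := p01 n n0.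
  by rewrite !gtr0_norm ?invr_gt0 // ler_pdivlMr // mulrC.
- move=> c c0 pc; apply: le_limn_einf => e e0.
  set x := 1 - expR (expR (- c) - 1).
  set L := 2 - (gamma_up c + gamma_lo c + gamma_up c * gamma_lo c) / c.
  have obl : \forall n \near \oo, n%:R * x <= expected_oblivious n (p n).
    near=> n.
    have n0 : (0 < n)%N by near: n; exact: nbhs_infty_gt.
    have := expected_oblivious_ge n0 (p01 n n0).
    have -> : p n * n%:R = c.
      by rewrite (_ : p n = c / n%:R) ?divfK ?pnatr_eq0 -?lt0n //; near: n.
    by [].
  have x0 : 0 < x.
    by rewrite subr_gt0 expR_lt1 subr_lt0 expR_lt1 oppr_lt0.
  have mx eps : 0 < eps -> \forall n \near \oo,
      expected_max_matching n (p n) <= n%:R * (L + eps).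
    move=> eps0; near=> n.
    rewrite (_ : p n = c / n%:R); last by near: n.
    by near: n; exact: expected_max_matching_gamma.
  (* Positivity of [L] comes from comparing the algorithm with the optimum, not from a study of the
     roots. *)
  have xL : x <= L.
    apply/ler_addgt0Pr => eps eps0; near \oo => n.
    have n0 : (0 < n)%N by near: n; exact: nbhs_infty_gt.
    rewrite -(@ler_pM2l _ n%:R) ?ltr0n //.
    apply: (@le_trans _ _ (expected_oblivious n (p n))); first by near: n.
    apply: (@le_trans _ _ (expected_max_matching n (p n))); last by near: n; exact: mx.
    by apply: expected_oblivious_le_max; have := p01 n n0; lra.
  have L0 : 0 < L := lt_le_trans x0 xL.
  have -> : (c - c * expR (expR (- c) - 1)) /
      (2 * c - (gamma_up c + gamma_lo c + gamma_up c * gamma_lo c)) = x / L.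
    have -> : c - c * expR (expR (- c) - 1) = c * x by rewrite /x; ring.
    have -> : 2 * c - (gamma_up c + gamma_lo c + gamma_up c * gamma_lo c) = c * L.
      by rewrite /L; field; rewrite gt_eqF.
    by field; rewrite !gt_eqF.
  have eL : 0 < e * L by rewrite mulr_gt0.
  near=> n.
  have n0 : (0 < n)%N by near: n; exact: nbhs_infty_gt.
  have nR : 0 < n%:R :> R by rewrite ltr0n.
  have m0 := expected_max_gt0 n0 (p01 n n0).
  rewrite /oblivious_ratio ler_pdivlMr //.
  have on : n%:R * x <= expected_oblivious n (p n) by near: n.
  have mn : expected_max_matching n (p n) <= n%:R * (L + e * L) by near: n; exact: mx.
  have xL1 : x / L <= 1 by rewrite ler_pdivrMr // mul1r.
  (* The upper bound on the optimum can be multiplied in only when the factor is positive; otherwise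
     the left side is at most 0. *)
  case: (leP (x / L - e) 0) => [neg|pos].
    apply: (@le_trans _ _ 0); first by rewrite mulr_le0_ge0 // ltW.
    by apply: le_trans on; rewrite mulr_ge0 ?ltW.
  apply: (@le_trans _ _ ((x / L - e) * (n%:R * (L + e * L)))); first by rewrite ler_pM2l.
  apply: le_trans on; rewrite mulrCA ler_pM2l //.
  (* Since [x / L <= 1], one has [(x / L - e) (1 + e) <= x / L]; this is why the slack was taken as
     [e * L]. *)
  have -> : (x / L - e) * (L + e * L) = (x / L - e) * (1 + e) * L by ring.
  by rewrite -ler_pdivlMr //; nra.
- move=> /eqoP small; apply/cvgrPdist_le => e e0.
  pose d := Num.min (e / 6) 4^-1.
  have d0 : 0 < d by rewrite lt_min divr_gt0 //= invr_gt0.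
  have de : 6 * d <= e by rewrite mulrC -ler_pdivlMr // ge_min lexx.
  have d4 : 0 < d <= 4^-1 by rewrite d0 ge_min lexx orbT.
  (* The domination hypothesis with constant [T^-1] says that [n p(n)] eventually exceeds any
     [T]. *)
  have large T : 0 < T -> \forall n \near \oo, T <= n%:R * p n.
    move=> T0; near=> n.
    have n0 : (0 < n)%N by near: n; exact: nbhs_infty_gt.
    have nR : 0 < n%:R :> R by rewrite ltr0n.
    have /andP[pn0 _] := p01 n n0.
    have : `|n%:R^-1 : R| <= T^-1 * `|p n| by near: n; apply: small; rewrite invr_gt0.
    rewrite !gtr0_norm ?invr_gt0 // -(ler_pM2l nR) mulfV ?gt_eqF //.
    by rewrite mulrCA mulrC ler_pdivlMr // mul1r.
  near=> n.
  have n0 : (0 < n)%N by near: n; exact: nbhs_infty_gt.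
  apply: le_trans de; apply: dist_ratio_dense => //; first exact: p01.
  + by rewrite mulrC -ler_pdivrMr //; near: n; exact: nbhs_infty_ger.
  + by rewrite mulrC -ler_pdivrMr //; near: n; apply: large; rewrite divr_gt0.
  + rewrite -ler_pdivrMr ?exprn_gt0 //; near: n; apply: large.
    by rewrite divr_gt0 ?exprn_gt0.
Unshelve. all: by end_near. Qed.
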